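(* Let $d\ge2$ be an integer and let $p,n$ be real with $p\ge n>d/2$. Choose $\rho\in(2\sqrt d,+\infty)$, $\mu\in(1,+\infty)$ and $m\in\mathbf N=\{0,1,2,\dots\}$. With $\mathcal K_{pn}:\mathbf Z^d_0\to(0,+\infty)$, $\mathcal K_{pn}(k):=4|k|^{2p}\sum_{h\in\mathbf Z^d_{0k}}\frac{|P_{h,k-h}|^2}{(|h|^p|k-h|^n+|h|^n|k-h|^p)^2}$, the following holds. (i) For all $k\in\mathbf Z^d_0$, $$\mathscr K_{pn}(k)<\mathcal K_{pn}(k)\le\mathscr K_{pn}(k)+\delta\mathscr K_{pn},$$ where $$\mathscr K_{pn}(k):=4|k|^{2p}\sum_{h\in\mathbf Z^d_{0k},\ |h|<\rho\text{ or }|k-h|<\rho}\frac{|P_{h,k-h}|^2}{(|h|^p|k-h|^n+|h|^n|k-h|^p)^2},$$ $$\delta\mathscr K_{pn}:=\frac{2\pi^{d/2}B_{pn}}{\Gamma(d/2)}\sum_{i=0}^{d-1}\binom{d-1}{i}\frac{d^{\,d/2-1/2-i/2}}{(2n-1-i)(\rho-2\sqrt d)^{2n-1-i}}.$$ Moreover $$\mathscr K_{pn}(k)=4|k|^{2p}\sum_{h\in\mathbf Z^d_{0k},\ |h|<\rho}\frac{|P_{h,k-h}|^2+H(|k-h|-\rho)\,|P_{k-h,h}|^2}{(|h|^p|k-h|^n+|h|^n|k-h|^p)^2},$$ and if $|k|\ge2\rho$, in this last formula one can replace $\mathbf Z^d_{0k}$ with $\mathbf Z^d_0$ and $H(|k-h|-\rho)$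 with $1$. (ii) For each $r\in\{1,\dots,d\}$, each permutation $\sigma$ of $\{1,\dots,d\}$ and each $k\in\mathbf Z^d_0$: $\mathscr K_{pn}(R_rk)=\mathscr K_{pn}(k)$ and $\mathscr K_{pn}(P_\sigma k)=\mathscr K_{pn}(k)$. (iii) For all $k\in\mathbf Z^d_0$, $$\mathscr K_{pn}(k)\le8\sum_{h\in\mathbf Z^d_{0k},\ |h|<\rho}\frac1{|h|^{2n}}E_{pn}\Big(\cos\vartheta_{hk},\frac{|h|}{|k|}\Big).$$ Furthermore, for all $k\in\mathbf Z^d$ with $|k|\ge\mu\rho$, $$\mathscr K_{pn}(k)\le8\sum_{j=0}^m\frac{\mathcal Q_{pnj}(\widehat k)}{|k|^{\gamma_{pnj}}}+8\,\frac{V_{pn}Y_{pn}}{|k|^{\gamma_{pn,m+1}}}\le\mathfrak K_{pn},$$ where $\widehat k=k/|k|$ and $$\mathcal Q_{pnj}:\mathbf S^{d-1}\to\mathbf R,\quad \mathcal Q_{pnj}(u):=\sum_{h\in\mathbf Z^d_0,|h|<\rho}\frac{Q_{pnj}(\cos\vartheta_{hu})}{|h|^{2n-\gamma_{pnj}}}$$ (these are polynomials in the components of $u$), $$V_{pn}:=\max_{c\in[-1,1],\,\xi\in[0,1/\mu]}S_{pn,m+1}(c,\xi),\qquad Y_{pn}:=\sum_{h\in\mathbf Z^d_0,|h|<\rho}\frac1{|h|^{2n-\gamma_{pn,m+1}}},$$ $$\mathfrak K_{pn}:=8\max_{u\in\mathbf S^{d-1},\,\epsilon\in[0,1/(\mu\rho)]}\Big(\sum_{j=0}^m\epsilon^{\gamma_{pnj}}\mathcal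 Q_{pnj}(u)+V_{pn}Y_{pn}\,\epsilon^{\gamma_{pn,m+1}}\Big).$$ (iv) One has $$\sup_{k\in\mathbf Z^d_0}\mathcal K_{pn}(k)\le\max\Big(\max_{k\in\mathbf Z^d_0,|k|<\mu\rho}\mathscr K_{pn}(k),\ \mathfrak K_{pn}\Big)+\delta\mathscr K_{pn}.$$
   Context: Notation. For $a,b\in\mathbf C^d$: $a\cdot b=\sum_ra_rb_r$, $|a|=\sqrt{\overline a\cdot a}$. $\mathbf Z^d_0=\mathbf Z^d\setminus\{0\}$, $\mathbf Z^d_{0k}=\mathbf Z^d\setminus\{0,k\}$. $\mathbf S^{d-1}$ is the unit sphere of $\mathbf R^d$. $\Gamma(\cdot)$ is the Euler Gamma function. $H$ is the Heaviside function: $H(z)=0$ for $z<0$, $H(z)=1$ for $z\ge0$. For $q,r\in\mathbf R^d\setminus\{0\}$, $\vartheta_{qr}\in[0,\pi]$ is the angle between them: $\cos\vartheta_{qr}=\frac{q\cdot r}{|q||r|}$. $R_r(k_1,\dots,k_r,\dots,k_d)=(k_1,\dots,-k_r,\dots,k_d)$ and $P_\sigma(k_1,\dots,k_d)=(k_{\sigma(1)},\dots,k_{\sigma(d)})$. Convention: $\xi^0=1$ for all $\xi\ge 0$, including $\xi=0$. For $k\in\mathbf R^d$, $k^\perp=\{a\in\mathbf C^d:k\cdot a=0\}$ and $\mathfrak L_k$ is the orthogonal projection of $\mathbf C^d$ onto $k^\perp$ ($\mathfrak L_0$ is the identity). For $h,\ell\in\mathbf Z^d_0$, $P_{h\ell}:h^\perp\times\ell^\perp\to(h+\ell)^\perp$,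 $P_{h\ell}(a,b)=\frac{a\cdot\ell}{|\ell|}\mathfrak L_{h+\ell}b$, and $|P_{h\ell}|=\min\{Q\ge0:|P_{h\ell}(a,b)|\le Q|a||b|\ \forall a\in h^\perp,b\in\ell^\perp\}$. $B_{pn}:=\max_{z\in[0,4],u\in[0,1]}b_{pn}(z,u)$, where $b_{pn}$ is the continuous function on $[0,4]\times[0,1]$ given by $$b_{pn}(z,u)=\frac{2z(4-z)(1-u)^{2n}u^{2n}(1-zu+zu^2)^p}{[(1-u)^{2n}+u^{2n}]\,[(1-u)^pu^n+(1-u)^nu^p]^2}\ (0<u<1),\qquad b_{pn}(z,0)=b_{pn}(z,1)=\frac{2z(4-z)}{1+3\delta_{pn}},$$ with $\delta_{pn}=1$ if $p=n$ and $0$ otherwise. Let $\mathscr E=\{(c,\xi)\in\mathbf R^2: c\in[-1,1],\ \xi\in[0,+\infty),\ (c,\xi)\ne(1,1)\}$ and $$E_{pn}:\mathscr E\to[0,+\infty),\quad E_{pn}(c,\xi)=\frac{1-c^2}{\big[(1-2c\xi+\xi^2)^{p/2+1/2}+\xi^{p-n}(1-2c\xi+\xi^2)^{n/2+1/2}\big]^2}.$$ Let $0=\gamma_{pn0}<\gamma_{pn1}<\gamma_{pn2}<\cdots$ be the increasing enumeration of $\{r+(p-n)s: r,s\in\mathbf N\}$. There are unique sequences of functions $Q_{pnj}\in C([-1,1],\mathbf R)$ ($j\in\mathbf N$) and $S_{pnj}\in C(\mathscr E,\mathbf R)$ ($j\in\mathbf N\setminus\{0\}$) such that for every $m\in\mathbf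 N$ and all $(c,\xi)\in\mathscr E$: $E_{pn}(c,\xi)=\sum_{j=0}^mQ_{pnj}(c)\,\xi^{\gamma_{pnj}}+S_{pn,m+1}(c,\xi)\,\xi^{\gamma_{pn,m+1}}$; the $Q_{pnj}$ are polynomials. *)

(* Defs.v *)
From HB Require Import structures.
From mathcomp Require Import all_boot all_order all_algebra perm spectral.
From mathcomp Require Import all_classical all_reals all_analysis.
From mathcomp Require Import complex.

Set Implicit Arguments.
Unset Strict Implicit.
Unset Printing Implicit Defensive.
Import Order.TTheory GRing.Theory Num.Theory.
Import numFieldNormedType.Exports.

Local Open Scope classical_set_scope.
Local Open Scope complex_scope.
Local Open Scope ring_scope.

(* The maximum (minimum) of [A], i.e. its greatest (least) element; the default
   value 0 is taken only if [A] has no such element. *)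
Definition maximum (R : realType) (A : set R) : R :=
  xget 0 (A `&` ubound A).

Definition minimum (R : realType) (A : set R) : R :=
  xget 0 (A `&` lbound A).

Definition Gamma (R : realType) (x : R) : R :=
  \int[lebesgue_measure]_(t in `]0, +oo[) (t `^ (x - 1) * expR (- t)).

Definition heaviside (R : realType) (z : R) : R := if z < 0 then 0 else 1.

(* Bilinear, without conjugation, also over the complex numbers. *)
Definition dot (K : comNzRingType) (d : nat) (a b : 'rV[K]_d) : K :=
  \sum_(r < d) a 0 r * b 0 r.

Definition norm2 (R : realType) (d : nat) (a : 'rV[R]_d) : R :=
  Num.sqrt (dot a a).

Definition cnorm2 (R : realType) (d : nat) (a : 'rV[R[i]]_d) : R :=
  Num.sqrt (complex.Re (dot (map_mx Num.conj a) a)).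

Definition sphere (R : realType) (d : nat) : set 'rV[R]_d :=
  [set u | norm2 u = 1].

Definition angle (R : realType) (d : nat) (q r : 'rV[R]_d) : R :=
  acos (dot q r / (norm2 q * norm2 r)).

Section Lattice.
Variables (R : realType) (d : nat).
Implicit Types k h l : 'rV[int]_d.

Definition rvec k : 'rV[R]_d := map_mx intr k.
Definition cvec k : 'rV[R[i]]_d := map_mx intr k.
Definition znorm k : R := norm2 (rvec k).

Definition Z0 : set 'rV[int]_d := [set h | h != 0].
Definition Z0k k : set 'rV[int]_d := [set h | h != 0 /\ h != k].

Definition reflect_coord (r : 'I_d) k : 'rV[int]_d :=
  \row_i (if i == r then - k 0 i else k 0 i).
Definition permute_coord (s : 'S_d) k : 'rV[int]_d := col_perm s k.

Definition perp k : set 'rV[R[i]]_d := [set a | dot (cvec k) a = 0].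

(* Hermitian-orthogonal projection onto [perp k]: the row space of
   [kermx (cvec k)^T] consists of the rows [a] with [a *m (cvec k)^T = 0]. *)
Definition Lproj k (a : 'rV[R[i]]_d) : 'rV[R[i]]_d :=
  a *m proj_ortho (kermx (cvec k)^T).

Definition Pmap h l (a b : 'rV[R[i]]_d) : 'rV[R[i]]_d :=
  (dot a (cvec l) / (znorm l)%:C) *: Lproj (h + l) b.

Definition Pnorm h l : R :=
  minimum [set Q : R | 0 <= Q /\ forall a b, perp h a -> perp l b ->
    cnorm2 (Pmap h l a b) <= Q * cnorm2 a * cnorm2 b].

End Lattice.

Section Kernel.
Variables (R : realType) (d : nat) (p n : R).
Implicit Types k h : 'rV[int]_d.

Definition weight k h : R :=
  (znorm R h `^ p * znorm R (k - h) `^ n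
   + znorm R h `^ n * znorm R (k - h) `^ p) ^+ 2.

Definition calK k : \bar R :=
  ((4 * znorm R k `^ (2 * p))%:E *
   \esum_(h in Z0k k) (Pnorm R h (k - h) ^+ 2 / weight k h)%:E)%E.

Definition scrK (rho : R) k : R :=
  4 * znorm R k `^ (2 * p) *
  \sum_(h \in [set h | Z0k k h /\ (znorm R h < rho \/ znorm R (k - h) < rho)])
    (Pnorm R h (k - h) ^+ 2 / weight k h).

End Kernel.

Section Bound.
Variables (R : realType) (p n : R).

Definition b_fun (z u : R) : R :=
  if (u == 0) || (u == 1) then
    2 * z * (4 - z) / (1 + 3 * (p == n)%:R)
  else
    2 * z * (4 - z) * (1 - u) `^ (2 * n) * u `^ (2 * n)
      * (1 - z * u + z * u ^+ 2) `^ p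
    / (((1 - u) `^ (2 * n) + u `^ (2 * n))
       * ((1 - u) `^ p * u `^ n + (1 - u) `^ n * u `^ p) ^+ 2).

Definition B_const : R :=
  maximum [set b_fun z u | z in `[0, 4]%classic & u in `[0, 1]%classic].

Definition deltaK (d : nat) (rho : R) : R :=
  2 * pi `^ (d%:R / 2) * B_const / Gamma (d%:R / 2 : R) *
  \sum_(i < d)
    ('C(d.-1, i)%:R * d%:R `^ (d%:R / 2 - 1 / 2 - i%:R / 2)
     / ((2 * n - 1 - i%:R)
        * (rho - 2 * Num.sqrt d%:R) `^ (2 * n - 1 - i%:R))).

End Bound.

Section Expansion.
Variables (R : realType) (p n : R).

Definition Edom : set (R * R) :=
  [set x | [/\ -1 <= x.1 <= 1, 0 <= x.2 & x <> (1, 1)]].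

Definition E_fun (c xi : R) : R :=
  (1 - c ^+ 2) /
  ((1 - 2 * c * xi + xi ^+ 2) `^ (p / 2 + 1 / 2)
   + xi `^ (p - n) * (1 - 2 * c * xi + xi ^+ 2) `^ (n / 2 + 1 / 2)) ^+ 2.

Definition is_exponent_enum (gamma : nat -> R) : Prop :=
  increasing_seq gamma /\
  range gamma = [set r%:R + (p - n) * s%:R | r in @setT nat & s in @setT nat].

(* The coefficient functions [Q j] are determined by the expansion on [-1, 1]
   only, and [S j] on [Edom] for 0 < j only. *)
Definition is_expansion (gamma : nat -> R)
    (Q : nat -> R -> R) (S : nat -> R * R -> R) : Prop :=
  [/\ forall j, {within `[-1, 1]%classic, continuous (Q j)},
      forall j, exists q : {poly R},
        forall c, -1 <= c <= 1 -> Q j c = q.[c],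
      forall j, (0 < j)%N -> {within Edom, continuous (S j)} &
      forall m c xi, Edom (c, xi) ->
        E_fun c xi = \sum_(j < m.+1) Q j c * xi `^ gamma j
                     + S m.+1 (c, xi) * xi `^ gamma m.+1].

Variables (d : nat) (rho mu : R) (m : nat).
Variables (gamma : nat -> R) (Q : nat -> R -> R) (S : nat -> R * R -> R).

Definition calQ (j : nat) (u : 'rV[R]_d) : R :=
  \sum_(h \in [set h | Z0 h /\ znorm R h < rho])
    (Q j (cos (angle (rvec R h) u)) / znorm R h `^ (2 * n - gamma j)).

Definition V_const : R :=
  maximum [set S m.+1 (c, xi) |
           c in `[-1, 1]%classic & xi in `[0, 1 / mu]%classic].

Definition Y_const : R :=
  \sum_(h \in [set h : 'rV[int]_d | Z0 h /\ znorm R h < rho])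
    (1 / znorm R h `^ (2 * n - gamma m.+1)).

Definition frakK : R :=
  8 * maximum [set \sum_(j < m.+1) eps `^ gamma j * calQ j u
                   + V_const * Y_const * eps `^ gamma m.+1 |
               u in @sphere R d & eps in `[0, 1 / (mu * rho)]%classic].

End Expansion.

(* Main.v *)
(** The term of [calK k] at [h] is at most
    [(B_const p n / 2) (|h|^(-2n) + |k - h|^(-2n))]: this is [b_fun] evaluated
    at [u = |h| / (|h| + |k - h|)] and [z = 2 (1 - cos t)], [t] being the angle
    between [h] and [k - h], because [|P_{h,k-h}| <= sin t].  Hence the part of
    the sum with [|h|, |k - h| >= rho] is at most [B_const p n] times
    [S = sum_(|h| >= rho) |h|^(-2n)].

    To bound [S] by [deltaK] one needs the exact volume of the unit ball of
    [R^d].  Let [N(r)] count the lattice points of norm at most [r].  Cutting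
    into cubes of side [M] gives
    [N(M (r - sqrt d)) <= M^d N(r) <= N(M (r + sqrt d))] for all [M], so any
    asymptotic bound on [N] is in fact a bound at every [r], up to a shift by
    [sqrt d].  The asymptotics come from the theta function:
    [sum_h exp(-|h|^2/K^2)] is on one side [(K sqrt pi)^d (1 + o(1))], and on
    the other side [int_0^oo N(K sqrt v) exp(-v) dv].  Abel summation against
    [N] then bounds [S].

    In [scrK] the sine of [t] is rewritten through the angle between [h] and
    [k], which turns the terms into values of [E_fun]; for [|k| >= mu rho] these
    are expanded termwise.  All maxima in the statement exist by
    compactness. *)

Require Import Defs.
From mathcomp Require Import all_boot all_order all_algebra perm spectral.
From mathcomp Require Import finmap.
From mathcomp Require Import all_classical all_reals all_analysis.
From mathcomp Require Import measurable_realfun complex.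
From mathcomp Require Import ring lra zify.
From mathcomp Require mpoly.
Import (canonicals) mpoly.
Set Implicit Arguments.
Unset Strict Implicit.
Unset Printing Implicit Defensive.
Import Order.TTheory GRing.Theory Num.Theory.
Import numFieldNormedType.Exports.
Local Open Scope classical_set_scope.
Local Open Scope ring_scope.

(** The shape of [deltaK] comes from two opposite shifts by q = sqrt d. Let omega be the volume of
    the unit ball. At most omega (t + q)^d lattice points have norm at most t, and at least omega (r
    - q)^d have norm at most r, for r just below rho. So the shell rho <= |h| <= t holds at most
    D(t) = omega ((t + q)^d - (rho - q)^d) points. D vanishes at t = rho - 2 q, and the Abel
    summation starts there: the boundary term disappears, and what remains is the integral of
    s^(-2n) D'(s). Expanding (s + q)^(d - 1) in it gives the sum over i, with the factor d omega = 2
    pi^(d/2) / Gamma(d/2) in front.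

    Strictness in (i) requires a far lattice point whose term is nonzero. It is found as h = k - l
    with l = N k + e_j, where e_j is not parallel to k and N is large; explicit test vectors show
    that |P_{h,l}| is positive there. *)

(** * Attained maxima and minima *)

Lemma maximumP (R : realType) (A : set R) x :
  A x -> ubound A x -> A (maximum A) /\ ubound A (maximum A).
Proof.
move=> Ax uAx; rewrite /maximum.
by case: xgetP => [y _ //|/(_ x) []].
Qed.

(** The extreme value theorem supplies the greatest element, so the default 0 is never taken. [A]
    and [f] are kept apart because the maxima of the statement are written with other expressions
    than the continuous functions that prove attainment. *)
Lemma le_maximum_compact (R : realType) (T : topologicalType) (K : set T)
    (f : T -> R) (A : set R) :
  compact K -> {within K, continuous f} -> A = f @` K ->
  forall x, A x -> x <= maximum A.
Proof.
move=> cK cf -> x [t Kt <-].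
have [|c cK' fc] := compact_EVT_max _ cK cf; first by exists t.
have [] := @maximumP _ (f @` K) (f c).
- by exists c => //; rewrite inE in cK'.
- by move=> y [s Ks <-]; apply: fc; rewrite inE.
by move=> _; apply; exists t.
Qed.

(** Each constraint is either independent of [q] (when [Y i = 0]) or the closed condition
    [X i / Y i <= q], so the infimum of the admissible constants is itself admissible. *)
Lemma minimum_lin_bound (R : realType) (I : Type) (P : set I) (X Y : I -> R)
    (A := [set q : R | 0 <= q /\ forall i, P i -> X i <= q * Y i]) :
  (forall i, P i -> 0 <= Y i) -> A !=set0 ->
  A (minimum A) /\ forall q, A q -> minimum A <= q.
Proof.
move=> Y0 [q0 Aq0].
have lbA : has_lbound A by exists 0 => q [].
have hinf : has_inf A by split => //; exists q0.
have Ainf : A (inf A).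
  split; first by apply: lb_le_inf; [exists q0 | move=> q []].
  move=> i Pi; have := Y0 i Pi; rewrite le_eqVlt => /predU1P[Yi|Yi].
    by have [_ /(_ i Pi)] := Aq0; rewrite -Yi !mulr0.
  rewrite -ler_pdivrMr//; apply: lb_le_inf; first by exists q0.
  by move=> q [_ /(_ i Pi)]; rewrite ler_pdivrMr.
rewrite /minimum; case: xgetP => [y _ [Ay lAy]|/(_ (inf A))].
  by split => // q Aq; exact: lAy.
by case; split => // q Aq; exact: ge_inf.
Qed.

(** * Vectors and the Hermitian projection *)

Section RealVectors.
Variables (K : comNzRingType) (d : nat).
Implicit Types a b c : 'rV[K]_d.

Lemma dotC a b : dot a b = dot b a.
Proof. by apply: eq_bigr => i _; rewrite mulrC. Qed.

Lemma dotDl a b c : dot (a + b) c = dot a c + dot b c.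
Proof. by rewrite -big_split; apply: eq_bigr => i _; rewrite mxE mulrDl. Qed.

Lemma dotZl t a b : dot (t *: a) b = t * dot a b.
Proof. by rewrite /dot mulr_sumr; apply: eq_bigr => i _; rewrite mxE mulrA. Qed.

Lemma dotBl a b c : dot (a - b) c = dot a c - dot b c.
Proof. by rewrite dotDl -scaleN1r dotZl mulN1r. Qed.

Lemma dotDr a b c : dot c (a + b) = dot c a + dot c b.
Proof. by rewrite dotC dotDl !(dotC c). Qed.

Lemma dotZr t a b : dot b (t *: a) = t * dot b a.
Proof. by rewrite dotC dotZl dotC. Qed.

Lemma dotBr a b c : dot c (a - b) = dot c a - dot c b.
Proof. by rewrite dotC dotBl !(dotC c). Qed.

Lemma dot_mulmx a b : dot a b = (a *m b^T) 0 0.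
Proof. by rewrite mxE; apply: eq_bigr => i _; rewrite mxE. Qed.

Lemma dot_orthogonal (M : 'M[K]_d) a b :
  M *m M^T = 1%:M -> dot (a *m M) (b *m M) = dot a b.
Proof.
by move=> MM; rewrite !dot_mulmx trmx_mul mulmxA -(mulmxA a) MM mulmx1.
Qed.

Lemma dot_delta a (i : 'I_d) : dot a (delta_mx 0 i) = a 0 i.
Proof.
rewrite /dot (bigD1 i)//= mxE !eqxx/= mulr1 big1 ?addr0// => j ji.
by rewrite mxE (negPf ji) andbF mulr0.
Qed.

End RealVectors.

Section Norms.
Variables (R : realType) (d : nat).
Implicit Types a b : 'rV[R]_d.

Lemma dot_ge0 a : 0 <= dot a a.
Proof. by apply: sumr_ge0 => i _; rewrite -expr2 sqr_ge0. Qed.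

Lemma dot_eq0 a : (dot a a == 0) = (a == 0).
Proof.
apply/idP/eqP => [|->]; last by rewrite /dot big1// => i _; rewrite mxE mul0r.
rewrite psumr_eq0 => [/allP h|i _]; last by rewrite -expr2 sqr_ge0.
apply/rowP => i; rewrite mxE.
by have := h i (mem_index_enum i); rewrite mulf_eq0 orbb => /eqP.
Qed.

Lemma dot_gt0 a : a != 0 -> 0 < dot a a.
Proof. by rewrite lt0r dot_eq0 dot_ge0 andbT. Qed.

Lemma norm2_ge0 a : 0 <= norm2 a. Proof. exact: sqrtr_ge0. Qed.

Lemma sqr_norm2 a : norm2 a ^+ 2 = dot a a.
Proof. by rewrite sqr_sqrtr// dot_ge0. Qed.

Lemma norm2_gt0 a : a != 0 -> 0 < norm2 a.
Proof. by move=> a0; rewrite sqrtr_gt0 dot_gt0. Qed.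

Lemma norm2Z t a : norm2 (t *: a) = `|t| * norm2 a.
Proof.
by rewrite /norm2 dotZl dotZr mulrA -expr2 sqrtrM ?sqr_ge0// sqrtr_sqr.
Qed.

Lemma norm2N a : norm2 (- a) = norm2 a.
Proof. by rewrite -scaleN1r norm2Z normrN1 mul1r. Qed.

Lemma dot_sqr_le a b : dot a b ^+ 2 <= dot a a * dot b b.
Proof.
have [->|b0] := eqVneq b 0.
  have -> : dot a 0 = 0 by rewrite /dot big1// => i _; rewrite mxE mulr0.
  by rewrite expr0n/= mulr_ge0// dot_ge0.
have := dot_ge0 (dot b b *: a - dot a b *: b).
rewrite dotBl !dotBr !dotZl !dotZr (dotC b a).
have := dot_gt0 b0; set B := dot b b; set A := dot a a; set C := dot a b => B0 h.
by rewrite -subr_ge0 -(pmulr_rge0 _ B0) (le_trans h)//; lra.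
Qed.

Lemma dot_le_norm2 a b : `|dot a b| <= norm2 a * norm2 b.
Proof.
rewrite -(@ler_pXn2r _ 2)// ?nnegrE ?mulr_ge0 ?norm2_ge0//.
by rewrite real_normK ?num_real// exprMn !sqr_norm2 dot_sqr_le.
Qed.

Lemma ler_norm2D a b : norm2 (a + b) <= norm2 a + norm2 b.
Proof.
rewrite -(@ler_pXn2r _ 2)// ?nnegrE ?addr_ge0 ?norm2_ge0//.
rewrite sqr_norm2 sqrrD !sqr_norm2 dotDl !dotDr (dotC b a).
by have := le_trans (ler_norm _) (dot_le_norm2 a b); lra.
Qed.

Lemma ler_norm2B a b : norm2 a - norm2 b <= norm2 (a - b).
Proof. by have := ler_norm2D (a - b) b; rewrite subrK; lra. Qed.

(* For [a] orthogonal to [h], only the component of [l] orthogonal to [h]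
   contributes to [dot a l]. *)
Lemma dot_perp_le a h l : h != 0 -> dot a h = 0 ->
  dot a l ^+ 2 <= dot a a * (dot l l - dot h l ^+ 2 / dot h h).
Proof.
move=> h0 ah.
have := dot_sqr_le a (l - (dot h l / dot h h) *: h).
rewrite dotBr dotZr ah mulr0 subr0 => /le_trans; apply.
rewrite ler_wpM2l ?dot_ge0// dotBl !dotBr !dotZl !dotZr (dotC l h).
by rewrite le_eqVlt; apply/orP; left; apply/eqP; field; rewrite gt_eqF// dot_gt0.
Qed.

End Norms.

Section Complexification.
Variables (R : realType) (d : nat).
Implicit Types (a b : 'rV[R[i]]_d) (k h l : 'rV[int]_d) (x y : 'rV[R]_d).

Definition reV a : 'rV[R]_d := map_mx (@complex.Re R) a.
Definition imV a : 'rV[R]_d := map_mx (@complex.Im R) a.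
Definition cplxV x : 'rV[R[i]]_d := map_mx (real_complex R) x.
(** Squared Hermitian norm. Lattice vectors are real, so separating real and imaginary parts turns
    each estimate on complex vectors into two estimates on real dot products. *)
Definition csq a : R := dot (reV a) (reV a) + dot (imV a) (imV a).

Lemma csq_ge0 a : 0 <= csq a.
Proof. by rewrite addr_ge0 ?dot_ge0. Qed.

Lemma sqr_cnorm2 a : cnorm2 a ^+ 2 = csq a.
Proof.
have -> : cnorm2 a = Num.sqrt (csq a).
  congr Num.sqrt; rewrite /dot /csq /dot -big_split/= raddf_sum.
  apply: eq_bigr => i _; rewrite !mxE; case: (a 0 i) => u v /=.
  by rewrite mulNr opprK.
by rewrite sqr_sqrtr// csq_ge0.
Qed.

Lemma cnorm2_ge0 a : 0 <= cnorm2 a. Proof. exact: sqrtr_ge0. Qed.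

Lemma cvecE k : cvec R k = cplxV (rvec R k).
Proof. by apply/rowP => i; rewrite !mxE rmorph_int. Qed.

Lemma dot_cplxV a x :
  dot a (cplxV x) = (dot (reV a) x)%:C%C + 'i%C * (dot (imV a) x)%:C%C.
Proof.
rewrite /dot !rmorph_sum/= mulr_sumr -big_split/=; apply: eq_bigr => i _.
rewrite !mxE; case: (a 0 i) => u v /=.
by apply/eqP; rewrite eq_complex/= !(mulr0, mul0r, mul1r, subr0, addr0, add0r, oppr0)
  !eqxx.
Qed.

Lemma csqZ (t : R[i]) a :
  csq (t *: a) = (complex.Re t ^+ 2 + complex.Im t ^+ 2) * csq a.
Proof.
rewrite /csq /dot -!big_split/= mulr_sumr; apply: eq_bigr => i _.
rewrite !mxE; case: t (a 0 i) => t1 t2 [u v] /=; ring.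
Qed.

Lemma reV_cplxV x : reV (cplxV x) = x.
Proof. by apply/rowP => i; rewrite !mxE. Qed.

Lemma imV_cplxV x : imV (cplxV x) = 0.
Proof. by apply/rowP => i; rewrite !mxE. Qed.

(** [proj_ortho] fixes the row space of the kernel matrix and kills its Hermitian complement;
    splitting [a] along [cvec R k] puts one summand in each. For [k = 0] the division by zero is
    harmless, as it multiplies the zero vector. *)
Lemma LprojE k a :
  Lproj k a = a - (dot a (cvec R k) / (dot (rvec R k) (rvec R k))%:C%C) *: cvec R k.
Proof.
have [->|k0] := eqVneq k 0.
  have -> : cvec R (0 : 'rV_d) = 0 by apply/rowP => i; rewrite !mxE.
  rewrite scaler0 subr0 /Lproj proj_ortho_id//.
  by apply/sub_kermxP; rewrite /cvec; apply/matrixP => i j;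
    rewrite !mxE big1// => r _; rewrite !mxE mulr0.
have rk0 : (dot (rvec R k) (rvec R k))%:C%C != 0 :> R[i].
  rewrite fmorph_eq0 dot_eq0; apply: contraNneq k0 => /rowP h; apply/eqP/rowP => i.
  by have /eqP := h i; rewrite !mxE intr_eq0 => /eqP.
have dkk : dot (cvec R k) (cvec R k) = (dot (rvec R k) (rvec R k))%:C%C.
  by rewrite cvecE dot_cplxV reV_cplxV imV_cplxV /dot [in X in _ + X]big1 ?mulr0
    ?addr0// => i _; rewrite mxE mul0r.
set t := _ / _; rewrite -[a in LHS](subrK (t *: cvec R k)) /Lproj mulmxDl.
rewrite proj_ortho_id; last first.
  apply/sub_kermxP/matrixP => i j; rewrite !ord1 -dot_mulmx dotBl dotZl mxE dkk.
  by rewrite divfK// subrr.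
rewrite proj_ortho_0 ?addr0//.
apply/orthomx1P; rewrite -scalemxAl.
have -> : ((kermx (cvec R k)^T)^t*)%sesqui =
  map_mx Num.conj (kermx (cvec R k)^T)^T by [].
apply/eqP; rewrite scaler_eq0; apply/orP; right; apply/eqP.
(* Transposing and conjugating the kernel equation gives the orthogonality, because [cvec R k] is
   fixed by conjugation. *)
have := mulmx_ker (cvec R k)^T => /(congr1 trmx)/(congr1 (map_mx Num.conj)).
rewrite trmx_mul trmxK map_mxM/= trmx0 map_mx0 => <-; congr (_ *m _).
by apply/rowP => i; rewrite !mxE/= rmorph_int.
Qed.

End Complexification.

(** * The operators P *)

Section Pnorm.
Variables (R : realType) (d : nat).
Implicit Types (k h l : 'rV[int]_d) (a b : 'rV[R[i]]_d).

Lemma rvec_eq0 k : (rvec R k == 0) = (k == 0).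
Proof.
apply/eqP/eqP => [/rowP h|->]; apply/rowP => i; last by rewrite !mxE.
by have /eqP := h i; rewrite !mxE intr_eq0 => /eqP.
Qed.

Lemma rvecD h l : rvec R (h + l) = rvec R h + rvec R l.
Proof. exact: map_mxD. Qed.

Lemma rvecB h l : rvec R (h - l) = rvec R h - rvec R l.
Proof. exact: map_mxB. Qed.

Lemma znorm_gt0 k : k != 0 -> 0 < znorm R k.
Proof. by rewrite -rvec_eq0; exact: norm2_gt0. Qed.

Lemma znorm_ge0 k : 0 <= znorm R k.
Proof. exact: norm2_ge0. Qed.

(** Gram determinant, polynomial in dot products: angles between lattice vectors then enter through
    [sin2], and trigonometric relations become identities for [ring] and [field]. *)
Definition gram h l : R :=
  dot (rvec R h) (rvec R h) * dot (rvec R l) (rvec R l)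
  - dot (rvec R h) (rvec R l) ^+ 2.

Lemma gram_ge0 h l : 0 <= gram h l.
Proof. by rewrite subr_ge0 dot_sqr_le. Qed.

Definition sin2 h l : R := gram h l / (znorm R h ^+ 2 * znorm R l ^+ 2).

Lemma sin2_ge0 h l : 0 <= sin2 h l.
Proof. by rewrite divr_ge0 ?gram_ge0// mulr_ge0 ?sqr_ge0. Qed.

Lemma csq_cplxV (x : 'rV[R]_d) : csq (cplxV x) = dot x x.
Proof.
by rewrite /csq reV_cplxV imV_cplxV [X in _ + X]big1 ?addr0// => i _; rewrite mxE mul0r.
Qed.

Lemma perpP k a :
  perp k a <-> dot (reV a) (rvec R k) = 0 /\ dot (imV a) (rvec R k) = 0.
Proof.
rewrite /perp /= dotC cvecE dot_cplxV; split.
  move=> /eqP; rewrite eq_complex/= !(mulr0, mul0r, mul1r, subr0, addr0, add0r, oppr0).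
  by move=> /andP[/eqP -> /eqP ->].
by move=> [-> ->]; rewrite mulr0 addr0.
Qed.

Lemma csq_Lproj k a : k != 0 -> csq (Lproj k a) =
  csq a - (dot (reV a) (rvec R k) ^+ 2 + dot (imV a) (rvec R k) ^+ 2)
          / dot (rvec R k) (rvec R k).
Proof.
rewrite -rvec_eq0 => k0; rewrite LprojE cvecE dot_cplxV.
set x := dot (reV a) _; set y := dot (imV a) _; set D := dot (rvec R k) _.
have D0 : D != 0 by rewrite dot_eq0.
have -> : (x%:C + 'i * y%:C)%C / D%:C%C = ((x / D)%:C + 'i * (y / D)%:C)%C.
  by rewrite mulrDl -mulrA !rmorphM/= !fmorphV.
set t := ((x / D)%:C + 'i * (y / D)%:C)%C; rewrite /csq.
have -> : reV (a - t *: cplxV (rvec R k)) = reV a - (x / D) *: rvec R k.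
  apply/rowP => i; rewrite !mxE; case: (a 0 i) => u v /=.
  by rewrite !(mulr0, mul0r, mul1r, subr0, addr0, add0r, oppr0).
have -> : imV (a - t *: cplxV (rvec R k)) = imV a - (y / D) *: rvec R k.
  apply/rowP => i; rewrite !mxE; case: (a 0 i) => u v /=.
  by rewrite !(mulr0, mul0r, mul1r, subr0, addr0, add0r, oppr0).
rewrite !dotBl !dotBr !dotZl !dotZr !(dotC (rvec R k)) -/x -/y -/D.
by field.
Qed.

Lemma csq_Lproj_le k a : csq (Lproj k a) <= csq a.
Proof.
have [->|k0] := eqVneq k 0.
  rewrite LprojE; have -> : cvec R (0 : 'rV_d) = 0 by apply/rowP => i; rewrite !mxE.
  by rewrite scaler0 subr0.
by rewrite csq_Lproj// lerBlDr lerDl divr_ge0 ?dot_ge0// addr_ge0 ?sqr_ge0.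
Qed.

Lemma csq_Pmap h l a b : csq (Pmap h l a b) =
  (dot (reV a) (rvec R l) ^+ 2 + dot (imV a) (rvec R l) ^+ 2) / znorm R l ^+ 2
  * csq (Lproj (h + l) b).
Proof.
rewrite /Pmap csqZ; congr (_ * _); rewrite cvecE dot_cplxV.
set x := dot (reV a) _; set y := dot (imV a) _.
have -> : ((x%:C + 'i * y%:C) / (znorm R l)%:C)%C
   = ((x / znorm R l)%:C + 'i * (y / znorm R l)%:C)%C.
  by rewrite mulrDl -mulrA !rmorphM/= !fmorphV.
rewrite /= !(mulr0, mul0r, mul1r, subr0, addr0, add0r, oppr0).
by rewrite !expr_div_n mulrDl.
Qed.

(** For [a] orthogonal to [h], only the part of [l] orthogonal to [h] meets [a], and its length is
    |l| times the sine; the projection that follows is a contraction. *)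
Lemma csq_Pmap_le h l a b : h != 0 -> l != 0 -> perp h a -> 
  csq (Pmap h l a b) <= sin2 h l * csq a * csq b.
Proof.
move=> h0 l0 /perpP[reh imh]; rewrite csq_Pmap.
rewrite ler_pM ?csq_ge0 ?csq_Lproj_le//.
  by rewrite divr_ge0 ?sqr_ge0// addr_ge0 ?sqr_ge0.
have rh0 : rvec R h != 0 by rewrite rvec_eq0.
have := lerD (dot_perp_le (rvec R l) rh0 reh) (dot_perp_le (rvec R l) rh0 imh).
have zl0 := znorm_gt0 l0; have zh0 := znorm_gt0 h0.
rewrite ler_pdivrMr ?exprn_gt0// => /le_trans; apply.
rewrite -mulrDl /sin2 /gram -/(csq a) !sqr_norm2 le_eqVlt; apply/orP; left.
by apply/eqP; field; rewrite !dot_eq0 !rvec_eq0 h0 l0.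
Qed.

(** Regroups the two quantified vectors into a pair, the single index that [minimum_lin_bound]
    expects. *)
Lemma Pnorm_minimum h l :
  Pnorm R h l = minimum [set q : R | 0 <= q /\
     forall ab : 'rV[R[i]]_d * 'rV[R[i]]_d, perp h ab.1 /\ perp l ab.2 ->
     cnorm2 (Pmap h l ab.1 ab.2) <= q * (cnorm2 ab.1 * cnorm2 ab.2)].
Proof.
congr minimum; apply/seteqP; split => q /= [q0 hq]; split => //.
  by move=> ab [? ?]; rewrite mulrA; exact: hq.
by move=> a b ha hb; rewrite -mulrA; apply: (hq (a, b)).
Qed.

Lemma Pnorm_prop h l : h != 0 -> l != 0 ->
  [/\ 0 <= Pnorm R h l, Pnorm R h l ^+ 2 <= sin2 h l &
    forall a b, perp h a -> perp l b ->
      csq (Pmap h l a b) <= Pnorm R h l ^+ 2 * csq a * csq b].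
Proof.
move=> h0 l0; rewrite Pnorm_minimum.
set A := (X in minimum X).
have Asin : A (Num.sqrt (sin2 h l)).
  split; first exact: sqrtr_ge0.
  move=> [a b]/= [ha hb]; rewrite -(@ler_pXn2r _ 2)// ?nnegrE ?cnorm2_ge0//.
    rewrite !exprMn (sqr_sqrtr (sin2_ge0 h l)) !sqr_cnorm2 mulrA.
    exact: csq_Pmap_le.
  by rewrite !mulr_ge0 ?sqrtr_ge0 ?cnorm2_ge0.
have [] := @minimum_lin_bound R _ (fun ab : 'rV[R[i]]_d * 'rV[R[i]]_d =>
  perp h ab.1 /\ perp l ab.2)
  (fun ab => cnorm2 (Pmap h l ab.1 ab.2)) (fun ab => cnorm2 ab.1 * cnorm2 ab.2).
- by move=> ab _; rewrite mulr_ge0 ?cnorm2_ge0.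
- by exists (Num.sqrt (sin2 h l)); exact: Asin.
rewrite -/A => -[m0 mA] mle; split=> //.
- rewrite -[leRHS]sqr_sqrtr ?sin2_ge0// ler_pXn2r ?nnegrE ?sqrtr_ge0//.
  exact: mle.
- move=> a b ha hb; have := mA (a, b) (conj ha hb) => /=.
  rewrite -(@ler_pXn2r _ 2)// ?nnegrE ?cnorm2_ge0 ?mulr_ge0 ?cnorm2_ge0//.
  by rewrite !exprMn !sqr_cnorm2 mulrA.
Qed.

(** [Pnorm] satisfies its own defining inequality, so one admissible pair with nonzero image is
    enough. *)
Lemma Pnorm_sqr_gt0 h l : h != 0 -> l != 0 -> h + l != 0 ->
  0 < gram h l -> dot (rvec R (h + l)) (rvec R l) != 0 -> 0 < Pnorm R h l ^+ 2.
Proof.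
move=> h0 l0 k0 G0 kl; have [P0 _ hP] := Pnorm_prop h0 l0.
set x := rvec R h; set y := rvec R l; set z := rvec R (h + l).
set X := dot x x; set Y := dot y y; set Z := dot z z.
have Y0 : 0 < Y by rewrite dot_gt0// rvec_eq0.
have Z0 : 0 < Z by rewrite dot_gt0// rvec_eq0.
(* Up to denominators, [a] is the component of [l] orthogonal to [h], and [b] that of [h + l]
   orthogonal to [l]. *)
pose a := cplxV (X *: y - dot x y *: x); pose b := cplxV (Y *: z - dot z y *: y).
have zD : z = x + y by exact: rvecD.
(* Adding [l] to [h] does not change the Gram determinant. *)
have GE : Z * Y - dot z y ^+ 2 = gram h l.
  by rewrite /Z zD /gram !dotDl !dotDr (dotC y x) -/x -/y -/Y; ring.
have ha : perp h a.
  apply/perpP; rewrite reV_cplxV imV_cplxV dotBl !dotZl -/x (dotC y x) mulrC subrr.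
  by split=> //; rewrite /dot big1// => i _; rewrite mxE mul0r.
have hb : perp l b.
  apply/perpP; rewrite reV_cplxV imV_cplxV dotBl !dotZl -/y mulrC subrr.
  by split=> //; rewrite /dot big1// => i _; rewrite mxE mul0r.
have := hP a b ha hb.
rewrite csq_Pmap csq_Lproj// !reV_cplxV !imV_cplxV -/y -/z !csq_cplxV sqr_norm2 -/y.
have -> : dot (0 : 'rV[R]_d) y = 0 by rewrite /dot big1// => i _; rewrite mxE mul0r.
have -> : dot (0 : 'rV[R]_d) z = 0 by rewrite /dot big1// => i _; rewrite mxE mul0r.
rewrite expr0n/= !addr0.
set lhs := (X in X <= _).
have -> : lhs = gram h l ^+ 3 * (dot z y) ^+ 2 / (Y * Z).
  have GE' : gram h l = X * Y - dot x y ^+ 2 by [].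
  rewrite /lhs !dotBl !dotBr !dotZl !dotZr (dotC y z) -/X -/Y -/Z.
  have -> : (X * Y - dot x y * dot x y) = gram h l by rewrite GE' expr2.
  have -> : Y * Z - dot z y * dot z y = gram h l by rewrite -GE; ring.
  rewrite -GE; field.
  by rewrite !gt_eqF.
move=> h1; have : 0 < Pnorm R h l ^+ 2 * csq a * csq b.
  rewrite !csq_cplxV; apply: lt_le_trans h1.
  have kl2 : 0 < dot z y ^+ 2 by rewrite lt0r sqrf_eq0 kl sqr_ge0.
  by apply: divr_gt0; apply: mulr_gt0 => //; exact: exprn_gt0.
rewrite -mulrA => h2; rewrite lt0r sqr_ge0 andbT.
by apply/eqP => h3; rewrite h3 mul0r ltxx in h2.
Qed.

End Pnorm.

(** * Invariance under integral orthogonal matrices *)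

Section Orthogonal.
Variables (R : realType) (d : nat) (M : 'M[int]_d).
Hypothesis MM : M *m M^T = 1%:M.
Implicit Types (k h l : 'rV[int]_d).

Let MR : 'M[R]_d := map_mx intr M.
Let MC : 'M[R[i]]_d := map_mx intr M.

Let MRM : MR *m MR^T = 1%:M.
Proof. by rewrite /MR map_trmx -map_mxM MM map_mx1. Qed.

Let MCM : MC *m MC^T = 1%:M.
Proof. by rewrite /MC map_trmx -map_mxM MM map_mx1. Qed.

Let rvecM k : rvec R (k *m M) = rvec R k *m MR. Proof. exact: map_mxM. Qed.
Let cvecM k : cvec R (k *m M) = cvec R k *m MC. Proof. exact: map_mxM. Qed.

Lemma znorm_orthogonal k : znorm R (k *m M) = znorm R k.
Proof. by rewrite /znorm /norm2 rvecM dot_orthogonal. Qed.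

Let csqM (a : 'rV[R[i]]_d) : cnorm2 (a *m MC) = cnorm2 a.
Proof.
rewrite /cnorm2; congr (Num.sqrt (complex.Re _)).
rewrite map_mxM/= (_ : map_mx Num.conj MC = MC) ?dot_orthogonal//.
by apply/matrixP => i j; rewrite !mxE/= rmorph_int.
Qed.

Let LprojM k (a : 'rV[R[i]]_d) : Lproj (k *m M) (a *m MC) = Lproj k a *m MC.
Proof.
by rewrite !LprojE cvecM rvecM !dot_orthogonal// mulmxBl scalemxAl.
Qed.

(** Multiplication by [M] carries test vectors for [h], [l] isometrically to test vectors for their
    images and commutes with [Pmap]. The converse is the same lemma for [M^T]. *)
Lemma Pnorm_set_orthogonal h l (q : R) :
  (forall a b, perp (h *m M) a -> perp (l *m M) b ->
    cnorm2 (Pmap (h *m M) (l *m M) a b) <= q * cnorm2 a * cnorm2 b) ->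
  forall a b, perp h a -> perp l b ->
    cnorm2 (Pmap h l a b) <= q * cnorm2 a * cnorm2 b.
Proof.
move=> hq a b ha hb; have := hq (a *m MC) (b *m MC).
rewrite /perp/= !cvecM !dot_orthogonal// => /(_ ha hb).
suff -> : Pmap (h *m M) (l *m M) (a *m MC) (b *m MC) = Pmap h l a b *m MC.
  by rewrite !csqM.
by rewrite /Pmap cvecM dot_orthogonal// znorm_orthogonal -mulmxDl LprojM scalemxAl.
Qed.

End Orthogonal.

Lemma Pnorm_orthogonal (R : realType) (d : nat) (M : 'M[int]_d) h l :
  M *m M^T = 1%:M -> Pnorm R (h *m M) (l *m M) = Pnorm R h l.
Proof.
move=> MM; have MM' : M^T *m (M^T)^T = 1%:M by rewrite trmxK mulmx1C.
congr minimum; apply/seteqP; split => q /= [q0 hq]; split => // a b.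
  exact: (Pnorm_set_orthogonal MM hq).
have hq' : forall a b, perp (h *m M *m M^T) a -> perp (l *m M *m M^T) b ->
    cnorm2 (Pmap (h *m M *m M^T) (l *m M *m M^T) a b) <= q * cnorm2 a * cnorm2 b.
  by rewrite -!mulmxA MM !mulmx1.
exact: (Pnorm_set_orthogonal MM' hq').
Qed.

(** * Counting lattice points *)

Lemma leq_size_inj (T U : eqType) (s : seq T) (t : seq U) (f : T -> U) :
  uniq s -> {in s &, injective f} -> (forall x, x \in s -> f x \in t) ->
  (size s <= size t)%N.
Proof.
move=> us finj fst; rewrite -(size_map f); apply: uniq_leq_size.
  by rewrite map_inj_in_uniq.
by move=> y /mapP[x xs ->]; exact: fst.
Qed.

Section Lattice.
Variables (R : realType) (d : nat).
Implicit Types (h k : 'rV[int]_d).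

(** Parametrizes the lattice cube [-L, L]^d by finite functions. This yields the finiteness of
    balls, and also the product form of the Gaussian sum over a cube. *)
Definition box_pt (L : nat) (f : {ffun 'I_d -> 'I_(2 * L).+1}) : 'rV[int]_d :=
  \row_i ((f i)%:Z - L%:Z).

Lemma box_pt_inj L : injective (@box_pt L).
Proof.
move=> f g /rowP fg; apply/ffunP => i; apply/val_inj.
by have := fg i; rewrite !mxE => /addIr [].
Qed.

Lemma dot_rvec h : dot (rvec R h) (rvec R h) = \sum_i ((h 0 i)%:~R : R) ^+ 2.
Proof. by apply: eq_bigr => i _; rewrite mxE expr2. Qed.

Lemma coord_le_znorm h (i : 'I_d) : `|(h 0 i)%:~R : R| <= znorm R h.
Proof.
rewrite -(@ler_pXn2r _ 2)// ?nnegrE ?znorm_ge0//.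
rewrite real_normK ?num_real// sqr_norm2 dot_rvec (bigD1 i)//= lerDl.
by apply: sumr_ge0 => j _; exact: sqr_ge0.
Qed.

Lemma znorm_le_box (L : nat) h : znorm R h <= L%:R -> exists f, h = box_pt (L := L) f.
Proof.
move=> hL; have hi i : `|h 0 i| <= L%:Z.
  have := le_trans (coord_le_znorm h i) hL.
  by rewrite -intr_norm -[L%:R]/(L%:Z%:~R) ler_int.
exists [ffun i => inord `|(h 0 i + L%:Z)%R|%N].
apply/rowP => i; rewrite !mxE ffunE inordK; have := hi i; rewrite ler_norml; lia.
Qed.

Definition zball (s : R) : set 'rV[int]_d := [set h | znorm R h <= s].

Lemma finite_zball s : finite_set (zball s).
Proof.
have [L sL] : exists L : nat, s <= L%:R.
  by exists (Num.truncn `|s|).+1; rewrite (le_trans (ler_norm s))// ltW// truncnS_gt.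
apply: (@sub_finite_set _ _ (range (@box_pt L))).
  by move=> h /= hs; have [f ->] := znorm_le_box (le_trans hs sL); exists f.
exact/finite_image/finite_finset.
Qed.

Definition zcount (s : R) : nat := #|` fset_set (zball s)|.

Lemma mem_zball s h : (h \in fset_set (zball s)) = (znorm R h <= s).
Proof.
rewrite in_fset_set; last exact: finite_zball.
by apply/idP/idP; rewrite inE.
Qed.

Lemma zcount_le s t : s <= t -> (zcount s <= zcount t)%N.
Proof.
move=> st; apply: fsubset_leq_card; apply/fsubsetP => h.
by rewrite !mem_zball => /le_trans; apply.
Qed.

Variable M : nat.
Hypothesis M0 : (0 < M)%N.

Let offset (o : {ffun 'I_d -> 'I_M}) : 'rV[int]_d := \row_i (o i)%:Z.

Let offset_norm o : znorm R (offset o) <= M%:R * Num.sqrt d%:R.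
Proof.
rewrite -(@ler_pXn2r _ 2)// ?nnegrE ?mulr_ge0 ?znorm_ge0 ?sqrtr_ge0//.
rewrite sqr_norm2 dot_rvec exprMn sqr_sqrtr//.
have -> : d%:R = \sum_(i < d) 1 :> R by rewrite sumr_const card_ord.
rewrite mulr_sumr; apply: ler_sum => i _.
rewrite mxE mulr1 ler_sqr ?nnegrE// -[(_ : int)%:~R]/((o i)%:R) ler_nat.
exact: ltnW.
Qed.

Let zpairs (r : R) := [seq (h, o) | h <- fset_set (zball r),
                                     o <- enum {ffun 'I_d -> 'I_M}].

Let zpairs_size r : size (zpairs r) = (M ^ d * zcount r)%N.
Proof. by rewrite size_allpairs -cardE card_ffun !card_ord mulnC. Qed.

(** By Euclidean division in each coordinate, M h + o with [o] in a cube of side M determines [h]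
    and [o]; the offset adds at most M sqrt d to the norm. *)
Lemma zcount_scale_ge (r : R) :
  (M ^ d * zcount r <= zcount (M%:R * (r + Num.sqrt d%:R)))%N.
Proof.
rewrite -(zpairs_size r).
pose g (x : 'rV[int]_d * {ffun 'I_d -> 'I_M}) : 'rV[int]_d :=
  M%:Z *: x.1 + offset x.2.
apply: (@leq_size_inj _ _ _ _ g).
- by rewrite allpairs_uniq ?fset_uniq ?enum_uniq// => -[? ?] [? ?] _ _ [-> ->].
- move=> [h o] [h' o'] _ _ /rowP gg.
  have MZ : M%:Z != 0 by move: M0; lia.
  have E i : h 0 i = h' 0 i /\ o i = o' i.
    have := gg i; rewrite !mxE/= => E.
    have q (z : int) (c : 'I_M) : ((M%:Z * z + c%:Z) %/ M%:Z)%Z = z.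
      by rewrite mulrC divzMDl// divz_small ?addr0//=; have := ltn_ord c; lia.
    have hh : h 0 i = h' 0 i by rewrite -(q (h 0 i) (o i)) E q.
    by split=> //; apply/val_inj; move: E; rewrite hh => /addrI [].
  by congr pair; [apply/rowP|apply/ffunP] => i; case: (E i).
- move=> _ /allpairsP[[h o] [/= + _ ->]]; rewrite !mem_zball /g/= => hr.
  have -> : znorm R (M%:Z *: h + offset o) =
    norm2 (M%:R *: rvec R h + rvec R (offset o)).
    rewrite /znorm rvecD; congr (norm2 (_ + _)).
    by apply/rowP => i; rewrite !mxE rmorphM.
  rewrite (le_trans (ler_norm2D _ _))// mulrDr lerD//; last exact: offset_norm.
  by rewrite norm2Z ger0_norm// ler_wpM2l.
Qed.

(** The same division read backwards: M times the quotient differs from [h] by an offset of norm at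
    most M sqrt d. *)
Lemma zcount_scale_le (r : R) :
  (zcount (M%:R * (r - Num.sqrt d%:R)) <= M ^ d * zcount r)%N.
Proof.
rewrite -(zpairs_size r).
have MZ : M%:Z != 0 by move: M0; lia.
have modM (z : int) : (`|(z %% M%:Z)%Z| < M)%N.
  by have := modz_ge0 z MZ; have := ltz_pmod z (M0 : 0 < M%:Z); lia.
pose g (h : 'rV[int]_d) : 'rV[int]_d * {ffun 'I_d -> 'I_M} :=
  (\row_i (h ord0 i %/ M%:Z)%Z, [ffun i => Ordinal (modM (h 0 i))]).
have gE h : h = M%:Z *: (g h).1 + offset (g h).2.
  apply/rowP => i; rewrite !mxE ffunE/= gez0_abs ?modz_ge0//.
  by rewrite mulrC -divz_eq.
apply: (@leq_size_inj _ _ _ _ g).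
- exact: fset_uniq.
- by move=> h h' _ _ hh; rewrite (gE h) hh -gE.
- move=> h; rewrite mem_zball => hr; apply/allpairsP; exists (g h).
  split; [|by rewrite mem_enum|by []].
  rewrite mem_zball.
  have MR : 0 < M%:R :> R by rewrite ltr0n.
  rewrite -(ler_pM2l MR).
  have -> : M%:R * znorm R (g h).1 = norm2 (rvec R h + - rvec R (offset (g h).2)).
    rewrite -[M%:R]ger0_norm// -norm2Z; congr norm2.
    rewrite {2}(gE h) rvecD addrK.
    by apply/rowP => i; rewrite !mxE rmorphM.
  rewrite (le_trans (ler_norm2D _ _))// norm2N.
  have := lerD hr (offset_norm (g h).2) => /le_trans; apply.
  by rewrite -mulrDr subrK.
Qed.

End Lattice.

(** * Gamma and theta integrals *)

Section GammaIntegral.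
Variable R : realType.
Notation mu := (@lebesgue_measure R).

Lemma integral_expR_itvy (c x : R) : 0 < c ->
  (\int[mu]_(v in `[x, +oo[) (c * expR (- (c * v)))%:E = (expR (- (c * x)))%:E)%E.
Proof.
move=> c0.
have cE : continuous (fun v : R => expR (- (c * v))).
  move=> v; apply: continuous_comp; last exact: continuous_expR.
  by apply: cvgN; apply: cvgM; [exact: cvg_cst|exact: cvg_id].
have dE (v : R) : is_derive v 1 (fun v => - expR (- (c * v))) (c * expR (- (c * v))).
  have h : is_derive v (1 : R) (fun v : R => - (c * v)) (- c).
    by apply: is_derive_eq; rewrite /GRing.scale/= mulr1.
  apply: is_derive_eq.
  by rewrite /GRing.scale/=; ring.
rewrite (@ge0_continuous_FTC2y _ _ (fun v => - expR (- (c * v))) _ 0).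
- by rewrite -EFinB sub0r opprK.
- by move=> v _; rewrite mulr_ge0 ?expR_ge0// ltW.
- by apply: continuous_subspaceT => v; apply: cvgM; [exact: cvg_cst|exact: cE].
- rewrite -oppr0; apply: cvgN.
  apply: (@cvg_comp _ _ _ (fun v => c * v) (fun z => expR (- z)) _ (pinfty_nbhs R)).
    exact: gt0_cvgMry.
  exact: cvgr_expR.
- by move=> v _; exact: ex_derive.
- by apply: cvgN; apply/cvg_at_right_filter; exact: cE.
- by move=> v _; rewrite derive1E; exact: derive_val.
Qed.

(** This is ln x <= x at x = v / (2 a); the constant is (2 a)^a. *)
Lemma powR_expR_le (a v : R) : 0 < a -> 0 <= v ->
  v `^ a <= expR (a * ln (2 * a)) * expR (v / 2).
Proof.
move=> a0; rewrite le_eqVlt => /predU1P[<-|v0].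
  by rewrite powR0 ?gt_eqF// mulr_ge0 ?expR_ge0.
rewrite /powR gt_eqF// -expRD ler_expR.
have := ln_sublinear (divr_gt0 v0 (mulr_gt0 (ltr0n R 2) a0)).
rewrite ln_div ?posrE ?mulr_gt0// => h.
have -> : v / 2 = a * (v / (2 * a)) by field; rewrite gt_eqF.
by rewrite -mulrDr ler_pM2l//; lra.
Qed.

Definition gam (a v : R) : R := v `^ a * expR (- v).

Lemma gam_ge0 a v : 0 <= gam a v.
Proof. by rewrite mulr_ge0 ?powR_ge0 ?expR_ge0. Qed.

Lemma measurable_gam a : measurable_fun setT (gam a).
Proof.
apply: measurable_funM; first exact: measurable_powR.
by apply: measurableT_comp => //; exact: oppr_measurable.
Qed.

Lemma gam_cvg0 a : 0 < a -> (gam a (n%:R : R)) @[n --> \oo] --> (0 : R).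
Proof.
move=> a0; set C := expR (a * ln (2 * a)).
have hz : (C * expR (- ((n%:R : R) / 2))) @[n --> \oo] --> (0 : R).
  rewrite -[X in _ --> X](mulr0 C); apply: cvgM; first exact: cvg_cst.
  apply: (@cvg_comp _ _ _ (fun n : nat => (n%:R : R) / 2) (fun z =>
    expR (- z)) _ (pinfty_nbhs R)).
    apply: (@cvg_comp _ _ _ (fun n : nat => n%:R : R) (fun v =>
      v / 2) _ (pinfty_nbhs R)).
      exact: cvgr_idn.
    by apply: gt0_cvgMly; [rewrite invr_gt0|exact: cvg_id].
  exact: cvgr_expR.
apply: (@squeeze_cvgr _ _ _ _ (cst 0) (fun n : nat =>
  C * expR (- ((n%:R : R) / 2)))) => //; last exact: cvg_cst.
apply: nearW => n; rewrite gam_ge0/= /gam.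
have := powR_expR_le a0 (ler0n R n); rewrite -/C => h.
rewrite (le_trans (ler_wpM2r (expR_ge0 _) h))// -mulrA ler_wpM2l ?expR_ge0//.
by rewrite -expRD ler_expR; lra.
Qed.

Lemma cvg_powR_right0 (a : R) : 0 <= a -> (v `^ a) @[v --> 0^'+] --> ((0 : R) `^ a).
Proof.
rewrite le_eqVlt => /predU1P[<-|a0].
  by rewrite powRr0; under eq_fun do rewrite powRr0; exact: cvg_cst.
by rewrite powR0 ?gt_eqF//; exact: powR_cvg0.
Qed.

Lemma cvg_powR (a v : R) : 0 < v -> (w `^ a) @[w --> v] --> (v `^ a).
Proof.
move=> v0; have : derivable (fun w : R => w `^ a) v 1.
  by apply: derivable_powR; rewrite in_itv/= v0.
by move=> /derivable1_diffP/differentiable_continuous.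
Qed.

(** This is Gamma(a + 1). With this shift the exponents needed below, d/2 and d/2 - 1, are
    nonnegative for d >= 2. *)
Definition Igam (a : R) : \bar R := (\int[mu]_(v in `[0%R, +oo[) (gam a v)%:E)%E.

Lemma Igam_ge0 a : (0 <= Igam a)%E.
Proof. by apply: integral_ge0 => v _; rewrite lee_fin gam_ge0. Qed.

Lemma Igam_fin (a : R) : 0 <= a -> Igam a \is a fin_num.
Proof.
move=> a0; rewrite ge0_fin_numE ?Igam_ge0//.
have [C C0 hC] : exists2 C : R, 0 <= C & forall v, 0 <= v -> v `^ a <= C * expR (v / 2).
  move: a0; rewrite le_eqVlt => /predU1P[<-|a0].
    exists 1 => // v v0; rewrite powRr0 mul1r (le_trans _ (expR_ge1Dx _))//.
    by rewrite lerDl divr_ge0.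
  by exists (expR (a * ln (2 * a))) => [|v]; [exact: expR_ge0|exact: powR_expR_le].
(* [g] has integral 1 on the half-line, and [2 * C * g] dominates the integrand. *)
pose g (v : R) : R := 2^-1 * expR (- (2^-1 * v)).
have mg : measurable_fun setT g.
  apply: measurable_funM => //; apply: measurableT_comp => //.
  by apply: measurableT_comp => //; exact: measurable_funM.
apply: (@le_lt_trans _ _ (\int[mu]_(v in `[0%R, +oo[) (2 * C * g v)%:E)%E).
  apply: ge0_le_integral => //.
  - by move=> v _; rewrite lee_fin gam_ge0.
  - by apply/measurable_EFinP/measurable_funTS; exact: measurable_gam.
  - by apply/measurable_EFinP/measurable_funTS; exact: measurable_funM.
  - move=> v; rewrite /= in_itv/= andbT => v0; rewrite lee_fin /gam /g.
    rewrite (le_trans (ler_wpM2r (expR_ge0 _) (hC v v0)))//.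
    have -> : expR (- v) = expR (- (v / 2)) * expR (- (v / 2)).
      by rewrite -expRD; congr expR; lra.
    rewrite mulrA -(mulrA C) -expRD subrr expR0 mulr1 (mulrC v).
    by rewrite [2 * C]mulrC -!mulrA (mulrA 2) divff// mul1r.
under eq_integral do rewrite EFinM.
rewrite ge0_integralZl//; last 3 first.
- by apply/measurable_EFinP; exact: measurable_funTS.
- by move=> v _; rewrite lee_fin mulr_ge0 ?expR_ge0.
- by rewrite lee_fin mulr_ge0.
by rewrite integral_expR_itvy// -EFinM ltry.
Qed.

Lemma Gamma_Igam (a : R) : Gamma a = fine (Igam (a - 1)).
Proof.
rewrite /Gamma /Rintegral /Igam; congr fine.
rewrite -integral_itv_obnd_cbnd//.
by apply/measurable_EFinP/measurable_funTS; exact: measurable_gam.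
Qed.

(** Integration by parts on [0, n], then n to infinity. The boundary term is 0 at the origin and
    tends to 0 at the other end; [1 <= a] makes [gam (a - 1)] continuous up to the origin. *)
Lemma Igam_rec (a : R) : 1 <= a -> Igam a = (a%:E * Igam (a - 1))%E.
Proof.
move=> a1; have a0 : 0 < a by lra.
have Jn (n : nat) : (a%:E * \int[mu]_(v in `[0%R, n%:R]) (gam (a - 1) v)%:E =
   \int[mu]_(v in `[0%R, n%:R]) (gam a v)%:E + (gam a n%:R)%:E)%E.
  case: n => [|n].
    have h0 f : (\int[mu]_(v in `[0%R, 0%:R]) f v = 0 :> \bar R)%E.
      by rewrite set_itv1 integral_set1.
    by rewrite !h0 mule0 add0e /gam powR0 ?gt_eqF// mul0r.
  set T : R := n.+1%:R.
  have T0 : 0 < T by rewrite ltr0n.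
  have cgam b : 0 <= b -> {within `[0%R, T], continuous (gam b)}.
    have cN : continuous (fun v : R => expR (- v)).
      by move=> v; apply: continuous_comp;
        [exact: oppr_continuous|exact: continuous_expR].
    move=> b0; apply/continuous_within_itvP => //; split.
    - move=> v; rewrite in_itv/= => /andP[v0 _].
      by apply: cvgM; [exact: cvg_powR|exact: cN].
    - apply: cvgM; first exact: cvg_powR_right0.
      by apply/cvg_at_right_filter; exact: cN.
    - by apply/cvg_at_left_filter; apply: cvgM; [exact: cvg_powR|exact: cN].
  have ca := cgam a (ltW a0); have ca1 : {within `[0%R, T], continuous (gam (a - 1))}.
    by apply: cgam; lra.
  have Ig f : {within `[0%R, T], continuous f} -> mu.-integrable `[0%R, T] (EFin \o f).
    by move=> cf; apply: continuous_compact_integrable => //; exact: segment_compact.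
  have E : (\int[mu]_(v in `[0%R, T]) (a * gam (a - 1) v - gam a v)%:E =
    a%:E * (\int[mu]_(v in `[0%R, T]) (gam (a - 1) v)%:E) - \int[mu]_(v in `[0%R, T])
      (gam a v)%:E)%E.
    under eq_integral do rewrite EFinB EFinM.
    rewrite integralB//=; [|by apply: integrableZl => //; exact: Ig|exact: Ig].
    by rewrite integralZl//; exact: Ig.
  have : (\int[mu]_(v in `[0%R, T]) (a * gam (a - 1) v - gam a v)%:E =
          (gam a T)%:E - (gam a 0)%:E)%E.
    apply: (@continuous_FTC2 _ _ (gam a)) => //.
    - by move=> v; apply: cvgB; [apply: cvgM; [exact: cvg_cst|exact: ca1]|exact: ca].
    - split.
      + move=> v; rewrite in_itv/= => /andP[v0 _].
        apply: derivableM; last exact: ex_derive.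
        by apply: derivable_powR; rewrite in_itv/= v0.
      + by move/(continuous_within_itvP _ T0) : ca => [].
      + by move/(continuous_within_itvP _ T0) : ca => [].
    - move=> v; rewrite in_itv/= => /andP[v0 _]; rewrite derive1E.
      have hp := is_derive1_powR a v0.
      have he : is_derive v 1 (fun v : R => expR (- v)) (- expR (- v)).
        by apply: is_derive_eq; rewrite /GRing.scale/=; ring.
      have := is_deriveM hp he => /(@derive_val _ _ _ _ _ _ _) ->.
      by rewrite /GRing.scale/= /gam; ring.
  rewrite E {4}/gam powR0 ?gt_eqF// mul0r sube0.
  have fin f : {within `[0%R, T], continuous f} -> (\int[mu]_(v in `[0%R, T]) (f
    v)%:E)%E \is a fin_num.
    by move=> cf; apply: (@integrable_fin_num _ _ _ mu `[0%R, T]%classic) => //;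
      exact: Ig.
  move=> <-; rewrite addeC subeK//; exact: fin.
have h2 := @ge0_cvgn_integral R mu (gam a) (gam_ge0 a) (measurable_gam a).
have h1 := @ge0_cvgn_integral R mu (gam (a - 1)) (gam_ge0 _) (measurable_gam _).
have fa : a%:E \is a fin_num by [].
have {}h1 := cvgeZl fa h1 : (_ @ \oo --> _).
have h3 : ((gam a (n%:R : R))%:E @[n --> \oo] --> (0%:E : \bar R))%E.
  by apply: cvg_EFin; [exact: nearW|exact: gam_cvg0].
have hd : (Igam a +? 0)%E by exact: fin_num_adde_defl.
have {}h2 := cvgeD hd h2 h3 : (_ @ \oo --> _).
rewrite adde0 in h2; have {}h2 := h2 eventually_filter.
move: h1; rewrite (funext Jn) => /(cvg_lim (@ereal_hausdorff R)) <-.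
by rewrite -[LHS](cvg_lim (@ereal_hausdorff R) h2).
Qed.

End GammaIntegral.

(** * Exponential sums as integrals of counting functions *)

Section LayerCake.
Variable R : realType.
Notation mu := (@lebesgue_measure R).

Definition count_le (s : seq R) (v : R) : R := (count (fun x => x <= v) s)%:R.

Let measurable_cnt s : measurable_fun setT (count_le s).
Proof.
elim: s => [|x s ih]; first exact: measurable_cst.
have -> : count_le (x :: s) = (\1_(`[x, +oo[%classic) \+ count_le s)%R.
  apply/funext => v; rewrite /count_le /= natrD indicE; congr (_%:R + _);
    congr nat_of_bool.
  by apply/idP/idP; rewrite inE/= in_itv/= andbT.
apply: measurable_funD => //; exact: measurable_indic.
Qed.

Let measurable_cnt_exp s : measurable_fun setT (fun v => count_le s v * expR (- v)).
Proof.
apply: measurable_funM => //.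
by apply: measurableT_comp => //; exact: oppr_measurable.
Qed.

Lemma integral_expRN : (\int[mu]_(v in `[0%R, +oo[) (expR (- v))%:E = 1)%E.
Proof.
transitivity (\int[mu]_(v in `[0%R, +oo[) (1 * expR (- (1 * v)))%:E)%E.
  by apply: eq_integral => v _; rewrite !mul1r.
by rewrite integral_expR_itvy// mulr0 oppr0 expR0.
Qed.

(** exp(-x) is the integral of exp(-v) over v >= x; summing over [s] turns the indicators of x <= v
    into the counting function. *)
Lemma layer_cake (s : seq R) : all (fun x => 0 <= x) s ->
  (\sum_(x <- s) expR (- x))%:E =
  (\int[mu]_(v in `[0%R, +oo[) (count_le s v * expR (- v))%:E)%E.
Proof.
elim: s => [_|x s ih /= /andP[x0 s0]].
  by rewrite big_nil integral0_eq// => v _; rewrite /count_le/= mul0r.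
rewrite big_cons EFinD ih//.
have -> : (expR (- x))%:E = (\int[mu]_(v in `[0%R, +oo[) (count_le [:: x] v * expR (-
  v))%:E)%E.
  have := integral_expR_itvy x (@ltr01 R); rewrite mul1r => <-.
  rewrite [LHS]integral_mkcond [RHS]integral_mkcond; apply: eq_integral => v _.
  rewrite !patchE !mem_setE !in_itv/= !andbT /count_le/= addn0 !mul1r.
  have [xv|] := leP x v; first by rewrite (le_trans x0 xv) ?mul1r.
  by move=> _; rewrite mul0r if_same.
rewrite -ge0_integralD//; last 4 first.
- by move=> v _; rewrite lee_fin mulr_ge0 ?expR_ge0 ?ler0n.
- apply/measurable_EFinP; apply: measurable_funTS; exact: measurable_cnt_exp.
- by move=> v _; rewrite lee_fin mulr_ge0 ?expR_ge0 ?ler0n.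
- apply/measurable_EFinP; apply: measurable_funTS; exact: measurable_cnt_exp.
apply: eq_integral => v _; rewrite -EFinD -mulrDl /count_le /=; congr (_ * _)%:E.
by rewrite -natrD addn0.
Qed.

Lemma layer_cake_le (s : seq R) (A C a : R) :
  all (fun x => 0 <= x) s -> 0 <= A -> 0 <= C -> 0 <= a ->
  (forall v, 0 <= v -> count_le s v <= A * v `^ a + C) ->
  \sum_(x <- s) expR (- x) <= A * fine (Igam a) + C.
Proof.
move=> s0 A0 C0 a0 hs; rewrite -lee_fin layer_cake//.
have mE : measurable_fun setT (fun v : R => expR (- v)).
  by apply: measurableT_comp => //; exact: oppr_measurable.
have hC : (\int[mu]_(v in `[0%R, +oo[) (C * expR (- v))%:E)%E = C%:E.
  under eq_integral do rewrite EFinM.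
  rewrite ge0_integralZl//; last by apply/measurable_EFinP; exact: measurable_funTS.
    by rewrite integral_expRN mule1.
rewrite EFinD EFinM fineK ?Igam_fin// -ge0_integralZl_EFin//; last 2 first.
- by move=> v _; rewrite lee_fin gam_ge0.
- by apply/measurable_EFinP/measurable_funTS; exact: measurable_gam.
rewrite -hC -ge0_integralD//; last 4 first.
- by move=> v _; rewrite -EFinM lee_fin mulr_ge0 ?gam_ge0.
- apply/measurable_EFinP; apply: measurable_funTS; apply: measurable_funM => //.
  exact: measurable_gam.
- by move=> v _; rewrite lee_fin mulr_ge0 ?expR_ge0.
- by apply/measurable_EFinP/measurable_funTS; exact: measurable_funM.
apply: ge0_le_integral => //.
- by move=> v _; rewrite lee_fin mulr_ge0 ?expR_ge0 ?ler0n.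
- apply/measurable_EFinP; apply: measurable_funTS; exact: measurable_cnt_exp.
- apply/measurable_EFinP; apply: measurable_funTS; apply: measurable_funD => //.
    by apply: measurable_funM => //; exact: measurable_gam.
  exact: measurable_funM.
- move=> v; rewrite /= in_itv/= andbT => v0.
  by rewrite -EFinM -EFinD lee_fin /gam mulrA -mulrDl ler_wpM2r ?expR_ge0// hs.
Qed.

(** The count is bounded below only up to [T], because a finite box contains whole balls only up to
    some radius; hence the truncated Gamma integral. The defect [C] costs at most [C], as exp(-v)
    has integral 1. *)
Lemma layer_cake_ge (s : seq R) (A C a T : R) :
  all (fun x => 0 <= x) s -> 0 <= A -> 0 <= C -> 0 <= a ->
  (forall v, 0 <= v <= T -> A * v `^ a - C <= count_le s v) ->
  (A%:E * \int[mu]_(v in `[0%R, T]) (gam a v)%:E <=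
    (\sum_(x <- s) expR (- x) + C)%:E)%E.
Proof.
move=> s0 A0 C0 a0 hs; rewrite EFinD layer_cake//.
have mE : measurable_fun setT (fun v : R => expR (- v)).
  by apply: measurableT_comp => //; exact: oppr_measurable.
have hC : (\int[mu]_(v in `[0%R, +oo[) (C * expR (- v))%:E)%E = C%:E.
  under eq_integral do rewrite EFinM.
  rewrite ge0_integralZl//; last by apply/measurable_EFinP; exact: measurable_funTS.
    by rewrite integral_expRN mule1.
rewrite -hC -ge0_integralD//; last 4 first.
- by move=> v _; rewrite lee_fin mulr_ge0 ?expR_ge0 ?ler0n.
- apply/measurable_EFinP; apply: measurable_funTS; exact: measurable_cnt_exp.
- by move=> v _; rewrite lee_fin mulr_ge0 ?expR_ge0.
- by apply/measurable_EFinP/measurable_funTS; exact: measurable_funM.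
rewrite -ge0_integralZl_EFin//; last 2 first.
- by move=> v _; rewrite lee_fin gam_ge0.
- by apply/measurable_EFinP/measurable_funTS; exact: measurable_gam.
have mS : measurable_fun setT (fun v =>
  (count_le s v * expR (- v))%:E + (C * expR (- v))%:E)%E.
  by apply/measurable_EFinP; apply: measurable_funD;
    [exact: measurable_cnt_exp|exact: measurable_funM].
apply: (@le_trans _ _ (\int[mu]_(v in `[0%R, T]) ((count_le s v * expR (- v))%:E + (C
  * expR (- v))%:E))%E).
  apply: ge0_le_integral => //.
  - by move=> v _; rewrite -EFinM lee_fin mulr_ge0 ?gam_ge0.
  - apply/measurable_EFinP; apply: measurable_funTS; apply: measurable_funM => //.
    exact: measurable_gam.
  - exact: measurable_funTS.
  - move=> v; rewrite /= in_itv/= => /hs h.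
    by rewrite -EFinM -EFinD lee_fin /gam mulrA -mulrDl ler_wpM2r ?expR_ge0//; lra.
apply: ge0_subset_integral => //.
- exact: measurable_funTS.
- by move=> v _; rewrite -EFinD lee_fin addr_ge0// mulr_ge0 ?expR_ge0 ?ler0n.
- by move=> v; rewrite /= !in_itv/= => /andP[->].
Qed.

End LayerCake.

Lemma cvg_natV0 (R : realType) : ((K%:R : R)^-1) @[K --> \oo] --> (0 : R).
Proof.
apply/(gtr0_cvgV0 _); last exact: cvgr_idn.
by exists 1%N => // n /= n0; rewrite ltr0n.
Qed.

(** * The one-dimensional theta sum *)

Section ThetaSum.
Variable R : realType.
Notation mu := (@lebesgue_measure R).

Definition gauss0 (x : R) : R := (\int[mu]_(t in `[0%R, x]) gauss_fun t)%R.

Let integrable_gauss (D : set R) :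
  measurable D -> mu.-integrable D (EFin \o @gauss_fun R).
Proof.
by move=> mD; apply: (@integrableS _ _ _ mu setT) => //; exact: integrableT_gauss.
Qed.

Let gauss_fun_decr (x y : R) : 0 <= x -> x <= y -> gauss_fun y <= gauss_fun x.
Proof.
move=> x0 xy; rewrite /gauss_fun ler_expR lerN2 ler_sqr ?nnegrE//.
exact: le_trans xy.
Qed.

Let F_increment (a b : R) : 0 <= a -> a <= b ->
  (b - a) * gauss_fun b <= gauss0 b - gauss0 a <= (b - a) * gauss_fun a.
Proof.
move=> a0 ab; rewrite /gauss0 Rintegral_itvB ?bnd_simp//; last exact: integrable_gauss.
have lD : (mu `]a, b] = (b - a)%:E)%E.
  by rewrite lebesgue_measure_itv/= lte_fin; case: ltgtP ab => // -> _; rewrite subrr.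
have cst_int (c : R) : mu.-integrable `]a, b] (EFin \o (cst c)).
  apply: measurable_bounded_integrable => //;
    first by rewrite /= lebesgue_measure_itv/=; case: ifPn => // _; rewrite -EFinB ltry.
  exact: bounded_cst.
have cstE (c : R) : (\int[mu]_(x in `]a, b]) cst c x)%R = (b - a) * c.
  by rewrite Rintegral_cst// mulrC; congr (_ * _); rewrite -[RHS]/(fine (b - a)%:E) -lD.
rewrite -!cstE; apply/andP; split; apply: le_Rintegral => //;
  try exact: integrable_gauss.
- move=> x; rewrite /= in_itv/= => /andP[ax xb]; apply: gauss_fun_decr => //.
  by rewrite ltW// (le_lt_trans a0).
- move=> x; rewrite /= in_itv/= => /andP[ax xb]; apply: gauss_fun_decr => //.
  exact: ltW.
Qed.

Let F0 : gauss0 0 = 0.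
Proof. by rewrite /gauss0 set_itv1 Rintegral_set1. Qed.

Let F_cvg : gauss0 n%:R @[n --> \oo] --> Num.sqrt pi / 2.
Proof.
have := @ge0_cvgn_integral R mu (@gauss_fun R) (@gauss_fun_ge0 R)
  (@measurable_gauss_fun R).
by rewrite integral0y_gauss => /fine_cvg.
Qed.

Lemma sum_centered (L : nat) (G : int -> R) :
  \sum_(j < (2 * L).+1) G (j%:Z - L%:Z) =
  G 0 + \sum_(j < L) (G j.+1%:Z + G (- j.+1%:Z)).
Proof.
elim: L => [|L ih]; first by rewrite muln0 big_ord1 big_ord0 [RHS]addr0.
rewrite (_ : (2 * L.+1).+1 = (2 * L).+1.+2)%N; last by rewrite mulnS.
rewrite big_ord_recl big_ord_recr/= [in RHS]big_ord_recr/= [RHS]addrA -ih.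
under eq_bigr => i _.
  rewrite (_ : (bump 0 i)%:Z - L.+1%:Z = i%:Z - L%:Z); last by rewrite /bump; lia.
  over.
rewrite sub0r (_ : (bump 0 (2 * L).+1)%:Z - L.+1%:Z = L.+1%:Z);
  last by rewrite /bump; lia.
by rewrite addrCA; congr (_ + _); rewrite addrC.
Qed.

(** The nodes j / K run over [-K, K] with step 1 / K: the single parameter [K] both refines the mesh
    and exhausts the line. *)
Definition theta (K : nat) : R :=
  \sum_(j < (2 * K ^ 2).+1) expR (- (((j%:Z - (K ^ 2)%:Z)%:~R : R) / K%:R) ^+ 2).

(** A Riemann sum of exp(-x^2) on [-K, K]. The function decreases on the positive half-line, so left
    and right sums there enclose [gauss0 K], and they differ by at most 1 / K. *)
Lemma theta_bounds (K : nat) : (0 < K)%N ->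
  2 * gauss0 K%:R - K%:R^-1 <= theta K / K%:R <= 2 * gauss0 K%:R + K%:R^-1.
Proof.
move=> K0; have KR : 0 < K%:R :> R by rewrite ltr0n.
rewrite /theta (sum_centered _ (fun z => expR (- ((z%:~R : R) / K%:R) ^+ 2))).
rewrite mul0r expr0n oppr0 expR0.
set L := (K ^ 2)%N; pose g (j : nat) : R := gauss_fun (j%:R / K%:R).
have -> : \sum_(j < L) (expR (- (((j.+1%:Z)%:~R : R) / K%:R) ^+ 2) +
     expR (- (((- j.+1%:Z)%:~R : R) / K%:R) ^+ 2)) = 2 * \sum_(j < L) g j.+1.
  rewrite mulr_sumr; apply: eq_bigr => j _.
  by rewrite rmorphN mulNr sqrrN /g /gauss_fun /= mulr_natl mulr2n.
have FL : gauss0 K%:R = \sum_(j < L) (gauss0 (j.+1%:R / K%:R) - gauss0 (j%:R / K%:R)).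
  rewrite -(big_mkord xpredT (fun j => gauss0 (j.+1%:R / K%:R) - gauss0 (j%:R / K%:R))).
  rewrite (telescope_sumr (fun j => gauss0 (j%:R / K%:R)))//.
  rewrite mul0r F0 subr0 /L natrX expr2 mulfK ?gt_eqF//.
have inc (j : nat) : g j.+1 / K%:R <= gauss0 (j.+1%:R / K%:R) - gauss0 (j%:R / K%:R)
  <= g j / K%:R.
  have := @F_increment (j%:R / K%:R) (j.+1%:R / K%:R).
  rewrite -mulrBl -natrB// subSnn mul1r !(mulrC K%:R^-1); apply.
    by rewrite divr_ge0.
  by rewrite ler_pM2r ?invr_gt0// ler_nat.
have h1 : (\sum_(j < L) g j.+1) / K%:R <= gauss0 K%:R.
  by rewrite FL mulr_suml; apply: ler_sum => j _; case/andP: (inc j).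
have h2 : gauss0 K%:R <= (1 + \sum_(j < L) g j.+1) / K%:R.
  rewrite FL (@le_trans _ _ ((\sum_(j < L) g j) / K%:R))//.
    by rewrite mulr_suml; apply: ler_sum => j _; case/andP: (inc j).
  rewrite ler_pM2r ?invr_gt0//.
  have -> : 1 = g 0%N by rewrite /g /gauss_fun mul0r expr0n oppr0 expR0.
  have -> : g 0%N + \sum_(j < L) g j.+1 = \sum_(j < L.+1) g j by rewrite big_ord_recl.
  by rewrite big_ord_recr/= lerDl gauss_fun_ge0.
have -> (S : R) : (1 + 2 * S) / K%:R = K%:R^-1 + 2 * (S / K%:R) by ring.
move: h2; rewrite (mulrDl 1) mul1r => h2.
by apply/andP; split; lra.
Qed.

Lemma theta_cvg : theta K / K%:R @[K --> \oo] --> Num.sqrt pi.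
Proof.
have -> : Num.sqrt pi = 2 * (Num.sqrt pi / 2) :> R by field.
have h0 := @cvg_natV0 R.
have h2 : (2 * gauss0 K%:R) @[K --> \oo] --> 2 * (Num.sqrt pi / 2).
  by apply: cvgM; [exact: cvg_cst|exact: F_cvg].
apply: (@squeeze_cvgr _ _ _ _ (fun K : nat =>
  2 * gauss0 K%:R - K%:R^-1) (fun K : nat => 2 * gauss0 K%:R + K%:R^-1)).
- by exists 1%N => // K /= K0; exact: theta_bounds.
- by rewrite -[X in _ --> X]subr0; apply: cvgB.
- by rewrite -[X in _ --> X]addr0; apply: cvgD.
Qed.

End ThetaSum.

(** * Gaussian sums over the lattice and the leading coefficient of the count *)

Section LatticeGauss.
Variables (R : realType) (d : nat).

Let pts (K : nat) : seq R :=
  [seq (znorm R (box_pt (L := K ^ 2) f) / K%:R) ^+ 2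
     | f <- enum {ffun 'I_d -> 'I_(2 * K ^ 2).+1}].

Let pts_ge0 K : all (fun x => 0 <= x) (pts K).
Proof. by apply/allP => x /mapP[f _ ->]; exact: sqr_ge0. Qed.

(** The Gaussian is a product over the coordinates, so its sum over a box is a power of the
    one-dimensional sum. *)
Let sum_pts K : \sum_(x <- pts K) expR (- x) = theta R K ^+ d.
Proof.
rewrite /pts big_map big_enum/=.
under eq_bigr => f _.
  rewrite expr_div_n sqr_norm2 dot_rvec mulr_suml -sumrN expR_sum.
  under eq_bigr => i _ do rewrite mxE -expr_div_n.
  over.
rewrite -[X in _ ^+ X]card_ord -prodr_const /theta.
by rewrite bigA_distr_bigA.
Qed.

Let pts_le (K : nat) (v : R) f : (0 < K)%N -> 0 <= v ->
  ((znorm R (box_pt (d := d) (L := K ^ 2) f) / K%:R) ^+ 2 <= v) =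
  (znorm R (box_pt f) <= K%:R * Num.sqrt v).
Proof.
move=> K0 v0; have KR : 0 < K%:R :> R by rewrite ltr0n.
rewrite -{1}(sqr_sqrtr v0) ler_pXn2r ?nnegrE ?sqrtr_ge0 ?divr_ge0 ?znorm_ge0//.
by rewrite ler_pdivrMr// mulrC.
Qed.

Let count_pts_le K v : (0 < K)%N -> 0 <= v ->
  count_le (pts K) v <= (zcount d (K%:R * Num.sqrt v))%:R.
Proof.
move=> K0 v0; rewrite /count_le ler_nat count_map -size_filter.
apply: (@leq_size_inj _ _ _ _ (@box_pt d (K ^ 2))).
- by rewrite filter_uniq// enum_uniq.
- by move=> f g _ _; exact: box_pt_inj.
- by move=> f; rewrite mem_filter/= pts_le// => /andP[h _]; rewrite mem_zball.
Qed.

(** For v <= K^2 the ball of radius K sqrt v fits in the box of half-side K^2, so no lattice point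
    is missed. *)
Let count_pts_ge K v : (0 < K)%N -> 0 <= v <= K%:R ^+ 2 ->
  (zcount d (K%:R * Num.sqrt v))%:R <= count_le (pts K) v.
Proof.
move=> K0 /andP[v0 vK]; rewrite /count_le ler_nat count_map -size_filter.
rewrite -(size_map (@box_pt d (K ^ 2))); apply: uniq_leq_size; first exact: fset_uniq.
move=> h; rewrite mem_zball => hK.
have [|f hf] := @znorm_le_box R d (K ^ 2) h.
  rewrite (le_trans hK)// natrX expr2 ler_wpM2l//.
  by rewrite -[leRHS]ger0_norm// -sqrtr_sqr ler_wsqrtr.
apply/mapP; exists f => //.
by rewrite mem_filter mem_enum/= pts_le// -hf hK.
Qed.

Let powK (K : nat) (v : R) : 0 <= v ->
  (K%:R * Num.sqrt v) ^+ d = K%:R ^+ d * v `^ (d%:R / 2).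
Proof.
by move=> v0; rewrite exprMn; congr (_ * _);
  rewrite -powR12_sqrt// -powR_mulrn ?powR_ge0// -powRrM mulrC.
Qed.

Let theta_pow_cvg : ((theta R K / K%:R) ^+ d) @[K --> \oo] --> (Num.sqrt pi ^+ d : R).
Proof.
apply: (@cvg_comp _ _ _ (fun K => theta R K / K%:R) (fun x =>
  x ^+ d) _ (nbhs (Num.sqrt pi : R))).
  exact: theta_cvg.
exact: exprn_continuous.
Qed.

Hypothesis d0 : (0 < d)%N.

Let invK_pow_cvg (C : R) : (C / K%:R ^+ d) @[K --> \oo] --> (0 : R).
Proof.
rewrite -[X in _ --> X](mulr0 C); apply: cvgM; first exact: cvg_cst.
have -> : (fun K : nat => (K%:R ^+ d : R)^-1) = (fun K : nat => ((K%:R : R)^-1) ^+ d).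
  by apply/funext => K; rewrite exprVn.
rewrite -[X in _ --> X](_ : (0 : R) ^+ d = 0); last by rewrite expr0n gtn_eqF.
apply: (@cvg_comp _ _ _ (fun K : nat => (K%:R : R)^-1) (fun x =>
  x ^+ d) _ (nbhs (0 : R))).
  exact: cvg_natV0.
exact: exprn_continuous.
Qed.

(** On the scaled points the hypothesis becomes A K^d v^(d/2) + C, and [C] disappears in the limit
    after division by K^d. So in such a bound [A] is at least the volume of the unit ball. *)
Lemma zcount_upper_pi (A C : R) : 0 <= A -> 0 <= C ->
  (forall s, 0 <= s -> (zcount d s)%:R <= A * s ^+ d + C) ->
  Num.sqrt pi ^+ d <= A * fine (Igam (d%:R / 2 : R)).
Proof.
move=> A0 C0 hz.
have hc : (A * fine (Igam (d%:R / 2)) + C / K%:R ^+ d) @[K --> \oo] -->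
          A * fine (Igam (d%:R / 2)) + 0.
  by apply: cvgD; [exact: cvg_cst|exact: invK_pow_cvg].
rewrite addr0 in hc.
apply: (ler_cvg_to theta_pow_cvg hc); exists 1%N => // K /= K0.
have KR : 0 < K%:R :> R by rewrite ltr0n.
have := @layer_cake_le R (pts K) (A * K%:R ^+ d) C (d%:R / 2) (pts_ge0 K).
rewrite sum_pts => h.
rewrite expr_div_n ler_pdivrMr ?exprn_gt0// mulrDl divfK ?gt_eqF ?exprn_gt0//.
rewrite mulrAC; apply: h => //.
- by rewrite mulr_ge0// exprn_ge0.
- move=> v v0; rewrite (le_trans (count_pts_le K0 v0))// -mulrA -powK//.
  by apply: hz; rewrite mulr_ge0 ?sqrtr_ge0.
Qed.

Lemma zcount_lower_pi (A C : R) : 0 <= A -> 0 <= C ->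
  (forall s, 0 <= s -> A * s ^+ d - C <= (zcount d s)%:R) ->
  A * fine (Igam (d%:R / 2 : R)) <= Num.sqrt pi ^+ d.
Proof.
move=> A0 C0 hz; have d2 : 0 <= d%:R / 2 :> R by rewrite divr_ge0.
have hc : ((theta R K / K%:R) ^+ d + C / K%:R ^+ d) @[K --> \oo] -->
          (Num.sqrt pi ^+ d + 0 : R).
  by apply: cvgD; [exact: theta_pow_cvg|exact: invK_pow_cvg].
rewrite addr0 in hc.
have hI := @ge0_cvgn_integral R (@lebesgue_measure R) (gam (d%:R / 2)) (gam_ge0 _)
  (measurable_gam _).
rewrite -/(Igam _) -(fineK (Igam_fin d2)) in hI.
have hA : (A * fine (\int[@lebesgue_measure R]_(x in `[0%R, K%:R]) (gam (d%:R / 2)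
  x)%:E)%E) @[K --> \oo] -->
          A * fine (Igam (d%:R / 2)).
  by apply: cvgM; [exact: cvg_cst|exact: fine_cvg].
apply: (ler_cvg_to hA hc); exists 1%N => // K /= K0.
have KR : 0 < K%:R :> R by rewrite ltr0n.
have Kd : 0 < K%:R ^+ d :> R by rewrite exprn_gt0.
have := @layer_cake_ge R (pts K) (A * K%:R ^+ d) C (d%:R / 2) K%:R (pts_ge0 K).
rewrite sum_pts => h.
have {}h : ((A * K%:R ^+ d)%:E *
     \int[@lebesgue_measure R]_(v in `[0%R, K%:R]) (gam (d%:R / 2) v)%:E <=
     (theta R K ^+ d + C)%:E)%E.
  apply: h => //; first by rewrite mulr_ge0// ltW.
  (* Truncating at [T = K] stays within the range v <= K^2 of [count_pts_ge], since K >= 1. *)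
  move=> v /andP[v0 vK]; rewrite -mulrA -powK//.
  have s0 : 0 <= K%:R * Num.sqrt v by rewrite mulr_ge0 ?sqrtr_ge0.
  apply: (le_trans (hz _ s0)).
  apply: count_pts_ge => //; rewrite v0/= (le_trans vK)//.
  by rewrite expr2 ler_peMl// ler1n.
rewrite expr_div_n -mulrDl ler_pdivlMr// mulrAC.
rewrite -lee_fin EFinM fineK//.
rewrite ge0_fin_numE; last by apply: integral_ge0 => v _; rewrite lee_fin gam_ge0.
apply: (@le_lt_trans _ _ (Igam (d%:R / 2)));
  last by rewrite -ge0_fin_numE ?Igam_ge0 ?Igam_fin.
apply: ge0_subset_integral => //.
- by apply/measurable_EFinP/measurable_funTS; exact: measurable_gam.
- by move=> v _; rewrite lee_fin gam_ge0.
- by move=> v; rewrite /= !in_itv/= => /andP[->].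
Qed.

End LatticeGauss.

(** * Lattice points and the volume of the ball *)

Section BallCount.
Variables (R : realType) (d : nat).
Hypothesis d2 : (2 <= d)%N.
Let d0 : (0 < d)%N. Proof. exact: leq_trans d2. Qed.

(** This is Gamma(d/2 + 1); the unit ball has volume pi^(d/2) / [V]. *)
Local Notation V := (fine (Igam (d%:R / 2 : R))).

Lemma Igam_half : V = d%:R / 2 * Gamma (d%:R / 2 : R).
Proof.
have h1 : 1 <= d%:R / 2 :> R by rewrite ler_pdivlMr// mul1r ler_nat.
rewrite Igam_rec// Gamma_Igam fineM//; apply: Igam_fin; lra.
Qed.

Let sd_gt0 : 0 < Num.sqrt d%:R :> R. Proof. by rewrite sqrtr_gt0 ltr0n. Qed.

Let cvg_scaled (a c : R) : (a * (1 + c * K%:R^-1) ^+ d) @[K --> \oo] --> a.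
Proof.
suff : (a * (1 + c * K%:R^-1) ^+ d) @[K --> \oo] --> a * (1 + c * 0) ^+ d.
  by rewrite mulr0 addr0 expr1n mulr1.
apply: cvgM; first exact: cvg_cst.
apply: (@cvg_comp _ _ _ (fun K : nat => 1 + c * (K%:R : R)^-1) (fun x =>
  x ^+ d) _ (nbhs (1 + c * 0 : R))); last exact: exprn_continuous.
by apply: cvgD; [exact: cvg_cst|apply: cvgM; [exact: cvg_cst|exact: cvg_natV0]].
Qed.

(** The scaling inequality propagates the density [a] found at radius [r] to all large radii, where
    [zcount_lower_pi] limits it. *)
Lemma zcount_le_volume (r : R) : 0 <= r ->
  (zcount d r)%:R * V <= Num.sqrt pi ^+ d * (r + Num.sqrt d%:R) ^+ d.
Proof.
move=> r0; set rho := r + _; have rho0 : 0 < rho by rewrite ltr_wpDl.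
have rho_ge0 := ltW rho0; have rhod : 0 < rho ^+ d by rewrite exprn_gt0.
rewrite -ler_pdivrMr// mulrAC; set a := (zcount d r)%:R / rho ^+ d.
have a0 : 0 <= a by rewrite divr_ge0// ltW.
have hN (s : R) : 0 <= s -> rho <= s -> a * (s - rho) ^+ d <= (zcount d s)%:R.
  move=> s0 rs; have := truncn_itv (divr_ge0 s0 (ltW rho0)).
  set M := Num.truncn _; rewrite ler_pdivlMr// ltr_pdivrMr// => /andP[h1 h2].
  have M0 : (0 < M)%N by rewrite truncn_gt0 ler_pdivlMr// mul1r.
  have := zcount_scale_ge d M0 r; rewrite -/rho => h3.
  have := leq_trans h3 (zcount_le d h1); rewrite -(ler_nat R) natrM natrX => h4.
  apply: le_trans h4; rewrite /a mulrAC ler_pdivrMr// (mulrC (_ ^+ d)) -mulrA -exprMn.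
  rewrite ler_wpM2l// lerXn2r ?nnegrE ?subr_ge0 ?mulr_ge0//.
  by move: h2; rewrite -natr1 mulrDl mul1r; lra.
have := @cvg_scaled (a * V) (-1) => hc.
apply: (ler_cvg_to hc (cvg_cst (Num.sqrt pi ^+ d))); exists 1%N => // K /= K0.
have KR : 0 < K%:R :> R by rewrite ltr0n.
have e0 : 0 <= 1 + -1 * K%:R^-1 :> R by rewrite mulN1r subr_ge0 invf_le1// ler1n.
rewrite mulrAC.
(* [zcount_lower_pi] wants a bound A s^d - C. For s >= rho K one has s - rho >= (1 - 1/K) s; for
   smaller s this C makes the bound nonpositive. At the end K tends to infinity. *)
have C0 : 0 <= a * (rho * K%:R) ^+ d.
  by apply: mulr_ge0 => //; apply: exprn_ge0; apply: mulr_ge0.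
apply: (@zcount_lower_pi R d d0 _ (a * (rho * K%:R) ^+ d)) => [||s s0].
- by apply: mulr_ge0 => //; exact: exprn_ge0.
- exact: C0.
have [sK|sK] := leP (rho * K%:R) s.
  rewrite lerBlDr (@le_trans _ _ (zcount d s)%:R)//; last first.
    by rewrite lerDl.
  have rs : rho <= s by rewrite (le_trans _ sK)// ler_peMr// ler1n.
  apply: le_trans (hN s s0 rs); rewrite -mulrA ler_wpM2l// -exprMn.
  rewrite lerXn2r ?nnegrE ?mulr_ge0 ?subr_ge0//.
  have : rho <= s / K%:R by rewrite ler_pdivlMr.
  by lra.
rewrite lerBlDr ler_wpDl// -mulrA ler_wpM2l// -exprMn lerXn2r ?nnegrE ?mulr_ge0//.
apply: le_trans (ltW sK); rewrite ler_piMl//.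
Qed.

(** Mirror image of the upper bound: s / rho is rounded up instead of down, and 1 + 1/K replaces 1 -
    1/K. *)
Lemma zcount_ge_volume (r : R) : Num.sqrt d%:R < r ->
  Num.sqrt pi ^+ d * (r - Num.sqrt d%:R) ^+ d <= (zcount d r)%:R * V.
Proof.
move=> r0; set rho := r - _; have rho0 : 0 < rho by rewrite subr_gt0.
have rho_ge0 := ltW rho0; have rhod : 0 < rho ^+ d by rewrite exprn_gt0.
rewrite -ler_pdivlMr// mulrAC; set a := (zcount d r)%:R / rho ^+ d.
have a0 : 0 <= a by rewrite divr_ge0// ltW.
have hN (s : R) : 0 <= s -> (zcount d s)%:R <= a * (s + rho) ^+ d.
  move=> s0; have srho : 0 <= s + rho by apply: addr_ge0.
  have := truncn_itv (divr_ge0 s0 (ltW rho0)).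
  set M := Num.truncn _; rewrite ler_pdivlMr// ltr_pdivrMr// => /andP[h1 h2].
  have := zcount_scale_le d (ltn0Sn M) r; rewrite -/rho => h3.
  have := leq_trans (zcount_le d (ltW h2)) h3; rewrite -(ler_nat R) natrM natrX => h4.
  apply: (le_trans h4); rewrite /a mulrAC ler_pdivlMr// mulrAC -exprMn mulrC.
  rewrite ler_wpM2l// lerXn2r ?nnegrE ?mulr_ge0//.
  by rewrite -natr1 mulrDl mul1r lerD2r.
clearbody a; have := @cvg_scaled (a * V) 1 => hc.
apply: (ler_cvg_to (cvg_cst (Num.sqrt pi ^+ d)) hc); exists 1%N => // K /= K0.
have KR : 0 < K%:R :> R by rewrite ltr0n.
have iK : 0 < K%:R^-1 :> R by rewrite invr_gt0.
have e0 : 0 <= 1 + 1 * K%:R^-1 :> R by lra.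
rewrite mulrAC.
have C0 : 0 <= a * (rho * K%:R + rho) ^+ d.
  by apply: mulr_ge0 => //; apply: exprn_ge0; apply: addr_ge0 => //; apply: mulr_ge0.
apply: (@zcount_upper_pi R d d0 _ (a * (rho * K%:R + rho) ^+ d)) => [||s s0].
- by apply: mulr_ge0 => //; exact: exprn_ge0.
- exact: C0.
rewrite (le_trans (hN s s0))//; have srho : 0 <= s + rho by apply: addr_ge0.
have [sK|sK] := leP (rho * K%:R) s.
  rewrite ler_wpDr//.
  rewrite -mulrA ler_wpM2l// -exprMn lerXn2r ?nnegrE ?mulr_ge0//.
  have : rho <= s / K%:R by rewrite ler_pdivlMr.
  by lra.
rewrite ler_wpDl//.
  by apply: mulr_ge0; [apply: mulr_ge0 => //; exact: exprn_ge0|exact: exprn_ge0].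
have sK' := lerD (ltW sK) (lexx rho).
by rewrite ler_wpM2l// lerXn2r ?nnegrE// (le_trans srho).
Qed.

(** Read off from the lower bound at r = sqrt d + 1, where a product of [V] with a natural number is
    at least pi^(d/2). *)
Lemma volume_gt0 : 0 < V.
Proof.
have := @zcount_ge_volume (Num.sqrt d%:R + 1); rewrite ltrDl => /(_ ltr01).
rewrite addrAC subrr add0r expr1n mulr1 => h.
have : 0 < (zcount d (Num.sqrt d%:R + 1 : R))%:R * V.
  by rewrite (lt_le_trans _ h)// exprn_gt0// sqrtr_gt0 pi_gt0.
by rewrite ltNge; apply: contraNT; rewrite -leNgt => V0; rewrite mulr_ge0_le0.
Qed.

End BallCount.

(** * The tail of the lattice sum *)

(* Discrete Abel summation: [Theta] plays the role of the integral of
   [- f' * D], where [D] dominates the counting function of [s]. *)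
Lemma abel_summation_le (R : realType) (a0 : R) (f D Theta : R -> R) :
  (forall a s, a0 <= a -> a <= s -> f s <= f a) ->
  (forall a s, a0 <= a -> a <= s -> D a * (f a - f s) <= Theta a - Theta s) ->
  forall (s : seq R) (T : R), a0 <= T -> all (fun x => a0 <= x <= T) s ->
  (forall t, a0 <= t -> count_le s t <= D t) ->
  \sum_(x <- s) (f x - f T) <= Theta a0 - Theta T.
Proof.
move=> fdecr DT s.
(* Decreasing order puts the largest point [x] first: the whole list lies below [x], so its length
   is at most [D x], and the cut-off drops from [T] to [x] for the remaining points. *)
have key : forall (s : seq R), sorted >=%R s -> forall T, a0 <= T ->
    all (fun x => a0 <= x <= T) s ->
    (forall t, a0 <= t -> count_le s t <= D t) ->
    \sum_(x <- s) (f x - f T) <= Theta a0 - Theta T.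
  elim => {s}[_|x s ih xs] T a0T.
    move=> _ /(_ a0 (lexx _)) D0; rewrite big_nil (le_trans _ (DT _ _ (lexx _) a0T))//.
    by rewrite mulr_ge0// subr_ge0 fdecr.
  move=> /= /andP[/andP[a0x xT] sT] hc.
  have sx : all (fun y => y <= x) s.
    by apply: (order_path_min _ xs) => y u v /= h1 h2; exact: le_trans h2 h1.
  have sx' : all (fun y => a0 <= y <= x) s.
    apply/allP => y ys; have /andP[-> _] := allP sT y ys.
    by rewrite (allP sx y ys).
  have hc' t : a0 <= t -> count_le s t <= D t.
    move=> /hc; apply: le_trans; rewrite /count_le ler_nat /= leq_addl//.
  have {}ih := ih (path_sorted xs) x a0x sx' hc'.
  have cx : count_le (x :: s) x = (size s).+1%:R.
    rewrite /count_le /= lexx add1n; congr (_.+1%:R).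
    by apply/eqP; rewrite -all_count.
  have := hc x a0x; rewrite cx => Dx.
  have fxT : 0 <= f x - f T by rewrite subr_ge0 fdecr.
  have E : \sum_(y <- x :: s) (f y - f T) =
      \sum_(y <- s) (f y - f x) + (size s).+1%:R * (f x - f T).
    rewrite big_cons -natr1 mulrDl mul1r addrA [RHS]addrC; congr (_ + _).
    have -> : (size s)%:R * (f x - f T) = \sum_(y <- s) (f x - f T).
      by rewrite big_const_seq count_predT iter_addr_0 mulr_natl.
    by rewrite -big_split/=; apply: eq_bigr => y _; ring.
  rewrite E; have := lerD ih (le_trans (ler_wpM2r fxT Dx) (DT _ _ a0x xT)).
  by move=> /le_trans; apply; lra.
move=> T a0T aT hc.
have p : perm_eq (sort (>=%R : rel R) s) s by rewrite perm_sort.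
rewrite -(perm_big _ p)/=; apply: key => //.
- by apply: sort_sorted => x y /=; rewrite orbC le_total.
- by rewrite (perm_all _ p).
- move=> t /hc; rewrite /count_le; apply: le_trans.
  by rewrite (seq.permP p).
Qed.

Section TailSum.
Variables (R : realType) (d : nat) (nu rho : R).
Hypothesis d2 : (2 <= d)%N.
Hypothesis dnu : d%:R < nu.
Hypothesis hrho : 2 * Num.sqrt d%:R < rho.

Let d0 : (0 < d)%N. Proof. exact: leq_trans d2. Qed.

Let q : R := Num.sqrt d%:R.
Let q0 : 0 < q. Proof. by rewrite sqrtr_gt0 ltr0n. Qed.
Let omega : R := Num.sqrt pi ^+ d / fine (Igam (d%:R / 2 : R)).
Let omega0 : 0 < omega.
Proof. by rewrite divr_gt0 ?exprn_gt0 ?sqrtr_gt0 ?pi_gt0 ?volume_gt0. Qed.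

Let a0 : R := rho - 2 * q.
Let a00 : 0 < a0. Proof. by rewrite subr_gt0. Qed.

Definition tail_coef (i : nat) : R :=
  'C(d.-1, i)%:R * d%:R `^ (d%:R / 2 - 1 / 2 - i%:R / 2).

Lemma tail_coef_ge0 i : 0 <= tail_coef i.
Proof. by rewrite mulr_ge0 ?powR_ge0. Qed.

Lemma tail_coefE (s : R) : \sum_(i < d) tail_coef i * s ^+ i = (s + q) ^+ d.-1.
Proof.
rewrite addrC exprDn prednK//; apply: eq_bigr => i _.
rewrite /tail_coef -[RHS]mulr_natl -[LHS]mulrA; congr (_ * _); congr (_ * _).
rewrite /q -powR12_sqrt// -powR_mulrn ?powR_ge0// -powRrM; congr (_ `^ _).
have id : (i <= d.-1)%N by rewrite -ltnS prednK.
rewrite natrB// -subn1 natrB//; lra.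
Qed.

Let f (s : R) : R := s `^ (- nu).
Let D (s : R) : R := omega * ((s + q) ^+ d - (rho - q) ^+ d).
(** The antiderivative of f' D that tends to 0 at infinity: the sum is the integral of d omega
    x^(-nu) (x + q)^(d - 1) over x >= s, taken term by term; [dnu] makes all its exponents
    negative. *)
Let Theta (s : R) : R := f s * D s +
  d%:R * omega * \sum_(i < d) (tail_coef i / (nu - 1 - i%:R)) * s `^ (i%:R + 1 - nu).

Let nui (i : 'I_d) : 0 < nu - 1 - i%:R.
Proof.
have : (i%:R : R) + 1 <= d%:R by rewrite natr1 ler_nat.
by move: dnu; lra.
Qed.

Let f_decr a s : a0 <= a -> a <= s -> f s <= f a.
Proof.
move=> a0a ls; have a_gt0 : 0 < a by exact: lt_le_trans a0a.
have s_gt0 : 0 < s by exact: lt_le_trans ls.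
rewrite /f !powRN lef_pV2 ?posrE ?powR_gt0// ge0_ler_powR// ?nnegrE ?ltW//.
by rewrite (lt_trans _ dnu)// ltr0n.
Qed.

Let D_incr a s : a0 <= a -> a <= s -> D a <= D s.
Proof.
move=> a0a ls; have a_gt0 : 0 < a by exact: lt_le_trans a0a.
rewrite /D ler_pM2l// lerD2r lerXn2r ?nnegrE ?lerD2r// ltW// addr_gt0//.
exact: lt_le_trans ls.
Qed.

(** As Theta' = f' D, the function [Theta - D a * f] has derivative f' (D - D a), which is
    nonpositive beyond [a] because f decreases and D increases. *)
Let Theta_step a s : a0 <= a -> a <= s -> D a * (f a - f s) <= Theta a - Theta s.
Proof.
move=> a0a ls; have a_gt0 : 0 < a by exact: lt_le_trans a0a.
pose g (x : R) : R := Theta x - D a * f x.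
suff : g s <= g a by rewrite /g mulrBr; lra.
pose df (x : R) : R := - nu * x `^ (- nu - 1).
have f_der (x : R) : 0 < x -> is_derive x 1 f (df x).
  by move=> x0; exact: is_derive1_powR.
have D_der (x : R) : is_derive x 1 D (omega * (d%:R * (x + q) ^+ d.-1)).
  have h : is_derive x 1 (fun s : R => (s + q) ^+ d) (d%:R * (x + q) ^+ d.-1).
    have := @is_deriveX R R (fun s : R => s + q) d x 1 1 _.
    rewrite /GRing.scale/= mulr1 mulr_natl.
    rewrite (_ : (fun s : R => s + q) ^+ d = (fun s => (s + q) ^+ d));
      first by apply; apply: is_derive_eq; rewrite addr0.
    by apply/funext => s'; rewrite exprfctE.
  by rewrite /D; apply: is_derive_eq; rewrite /GRing.scale/=; ring.
have T_der (x : R) : 0 < x -> is_derive x 1 Theta (df x * D x).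
  move=> x0; have h1 := f_der x x0; have h2 := D_der x.
  have S_der : is_derive x 1 (fun s : R =>
    \sum_(i < d) (tail_coef i / (nu - 1 - i%:R)) * s `^ (i%:R + 1 - nu))
      (\sum_(i < d) (tail_coef i / (nu - 1 - i%:R)) * ((i%:R + 1 - nu) * x `^ (i%:R +
        1 - nu - 1))).
    have := @is_derive_sum R R R d (fun i s =>
      (tail_coef i / (nu - 1 - i%:R)) * s `^ (i%:R + 1 - nu)) x 1
      (fun i => (tail_coef i / (nu - 1 - i%:R)) * ((i%:R + 1 - nu) * x `^ (i%:R + 1 -
        nu - 1))).
    rewrite fct_sumE; apply => i.
    have hp := is_derive1_powR (i%:R + 1 - nu) x0.
    by apply: is_derive_eq; rewrite /GRing.scale/=.
  rewrite /Theta; apply: is_derive_eq; rewrite /GRing.scale/=.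
  have -> : \sum_(i < d) tail_coef i / (nu - 1 - i%:R) * ((i%:R + 1 - nu) * x `^
    (i%:R + 1 - nu - 1))
     = - (f x * (x + q) ^+ d.-1).
    rewrite -tail_coefE mulr_sumr -sumrN; apply: eq_bigr => i _.
    have -> : i%:R + 1 - nu - 1 = i%:R + - nu by ring.
    rewrite powRD; last by rewrite (gt_eqF x0) implybT.
    rewrite powR_mulrn ?ltW// -/(f x).
    by field; rewrite gt_eqF.
  by ring.
have g_der (x : R) : 0 < x -> is_derive x 1 g (df x * (D x - D a)).
  move=> x0; have h1 := T_der x x0; have h2 := f_der x x0.
  by rewrite /g; apply: is_derive_eq; rewrite /GRing.scale/=; ring.
have inI x : x \in `]a, s[ -> 0 < x.
  by rewrite in_itv/= => /andP[ax _]; exact: lt_trans ax.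
apply: (@ler0_derive1_le_cc _ g a s) => //.
- by move=> x /inI x0; have := g_der x x0; move=> ?; exact: ex_derive.
- move=> x xI; have x0 := inI x xI; have h := g_der x x0.
  rewrite derive1E derive_val mulr_le0_ge0//.
    by rewrite /df mulNr oppr_le0 mulr_ge0 ?powR_ge0// ltW// (lt_trans _ dnu)// ltr0n.
  by rewrite subr_ge0 D_incr//; move: xI; rewrite in_itv/= => /andP[/ltW].
- apply: derivable_within_continuous => x; rewrite in_itv/= => /andP[ax _].
  have x0 : 0 < x by exact: lt_le_trans ax.
  by have := g_der x x0; move=> ?; exact: ex_derive.
- by rewrite in_itv/= lexx andbT.
- by rewrite in_itv/= lexx.
Qed.

Let Theta_ge0 s : a0 <= s -> rho <= s -> 0 <= Theta s.
Proof.
move=> a0s rs; rewrite /Theta addr_ge0//.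
  rewrite mulr_ge0 ?powR_ge0// mulr_ge0 ?(ltW omega0)// subr_ge0.
  rewrite lerXn2r ?nnegrE//.
  - by rewrite subr_ge0; move: (ltW hrho) q0; rewrite -/q; lra.
  - by rewrite addr_ge0 ?(ltW q0)// (le_trans _ a0s)// ltW.
  - by move: q0 rs; lra.
apply: mulr_ge0; first by rewrite mulr_ge0 ?(ltW omega0).
apply: sumr_ge0 => i _; rewrite mulr_ge0 ?powR_ge0// divr_ge0 ?tail_coef_ge0//.
exact/ltW/nui.
Qed.

Definition tail_bound : R :=
  2 * pi `^ (d%:R / 2) / Gamma (d%:R / 2 : R) *
  \sum_(i < d) (tail_coef i /
    ((nu - 1 - i%:R) * (rho - 2 * Num.sqrt d%:R) `^ (nu - 1 - i%:R))).

Let Theta_a0 : Theta a0 = tail_bound.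
Proof.
rewrite /Theta /D (_ : a0 + q = rho - q); last by rewrite /a0; ring.
rewrite subrr !mulr0 add0r /tail_bound.
have -> : d%:R * omega = 2 * pi `^ (d%:R / 2) / Gamma (d%:R / 2 : R).
  have := volume_gt0 R d2; rewrite /omega (Igam_half R d2) => V0.
  have -> : Num.sqrt pi ^+ d = pi `^ (d%:R / 2) :> R.
    by rewrite -powR12_sqrt ?pi_ge0// -powR_mulrn ?powR_ge0// -powRrM mulrC.
  field; rewrite pnatr_eq0 gtn_eqF// andbT.
  by apply: contraTneq V0 => ->; rewrite mulr0 ltxx.
congr (_ * _); apply: eq_bigr => i _.
rewrite invfM mulrA -powRN; congr (_ * _ `^ _); ring.
Qed.

(** For r < rho <= t, the points of [s] of norm at most t and the ball of radius r are disjoint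
    parts of the ball of radius t. [zcount] counts closed balls and [s] may contain points of norm
    exactly [rho], so r stays below [rho] and tends to it only in the final bound. *)
Let zcount_shell_le (s : seq 'rV[int]_d) : uniq s ->
  all (fun h => rho <= znorm R h) s -> forall t, a0 <= t ->
  count_le [seq znorm R h | h <- s] t <= D t.
Proof.
move=> us rs t a0t; have V0 := volume_gt0 R d2.
have t0 : 0 < t := lt_le_trans a00 a0t.
have rq : 0 < rho - q by rewrite subr_gt0; move: hrho q0; rewrite -/q; lra.
have [rt|tr] := leP rho t; last first.
  have -> : count_le [seq znorm R h | h <- s] t = 0.
    apply/eqP; rewrite pnatr_eq0 -leqn0 leqNgt -has_count; apply/hasPn => x.
    move=> /mapP[h hs ->]; rewrite -ltNge (lt_le_trans tr)//.
    exact: (allP rs).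
  rewrite mulr_ge0 ?(ltW omega0)// subr_ge0 lerXn2r ?nnegrE ?(ltW rq)//.
    by rewrite addr_ge0 ?(ltW q0)// ltW.
  by move: a0t; rewrite /a0; lra.
have key r : 2 * q < r -> r < rho ->
    count_le [seq znorm R h | h <- s] t <= omega * ((t + q) ^+ d - (r - q) ^+ d).
  move=> qr rr; have r0 : 0 <= r by move: q0; lra.
  have h1 := zcount_le_volume d2 (ltW t0).
  have h2 : Num.sqrt pi ^+ d * (r - q) ^+ d <= (zcount d r)%:R * fine (Igam (d%:R / 2
    : R)).
    by apply: zcount_ge_volume => //; rewrite -/q; move: q0; lra.
  have h3 : count_le [seq znorm R h | h <- s] t + (zcount d r)%:R <= (zcount d t)%:R.
    rewrite /count_le -natrD ler_nat count_map -size_filter /zcount -size_cat.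
    apply: uniq_leq_size.
      rewrite cat_uniq filter_uniq// fset_uniq andbT/=.
      apply/hasPn => h; rewrite mem_zball => hr; rewrite mem_filter/= negb_and.
      apply/orP; right; apply/negP => hs.
      by have := allP rs h hs; rewrite leNgt (le_lt_trans hr rr).
    move=> h; rewrite mem_cat mem_filter/= => /orP[/andP[ht _]|].
      by rewrite mem_zball.
    by rewrite !mem_zball => /le_trans; apply; rewrite ltW// (lt_le_trans rr).
  rewrite -(ler_pM2r V0) /omega mulrAC divfK ?gt_eqF//.
  rewrite mulrBr; move: h1 h2; rewrite -/q => h1 h2.
  by have := ler_wpM2r (ltW V0) h3; rewrite mulrDl; lra.
have hc : (omega * ((t + q) ^+ d - (r - q) ^+ d)) @[r --> rho^'-] -->
    omega * ((t + q) ^+ d - (rho - q) ^+ d).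
  apply: cvg_at_left_filter; apply: cvgM; first exact: cvg_cst.
  apply: cvgB; first exact: cvg_cst.
  apply: (@cvg_comp _ _ _ (fun r => r - q) (fun x => x ^+ d) _ (nbhs (rho - q)));
    last exact: exprn_continuous.
  by apply: cvgB; [exact: cvg_id|exact: cvg_cst].
apply: (ler_cvg_to (cvg_cst _) hc); near=> r; apply: key.
  by near: r; exact: nbhs_left_gt.
by near: r; exact: nbhs_left_lt.
Unshelve. all: by end_near. Qed.

Lemma tail_sum_le (s : seq 'rV[int]_d) : uniq s ->
  all (fun h => rho <= znorm R h) s ->
  \sum_(h <- s) znorm R h `^ (- nu) <= tail_bound.
Proof.
move=> us rs; have hcount := zcount_shell_le us rs.
set n : R := (size s)%:R.
have a0rho : a0 <= rho by rewrite /a0; move: q0; lra.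
have nu1 : 1 < nu by rewrite (lt_trans _ dnu)// ltr1n.
(* Abel summation controls the sum of f(x) - f(T). The remainder [n * f T] vanishes as [T] grows,
   since [s] is fixed. *)
have key T : rho <= T -> all (fun h => znorm R h <= T) s ->
    \sum_(h <- s) znorm R h `^ (- nu) <= tail_bound + n * f T.
  move=> rT sT; have a0T := le_trans a0rho rT.
  have := @abel_summation_le R a0 f D Theta f_decr Theta_step
    [seq znorm R h | h <- s] T a0T _ hcount.
  have aT : all (fun x => a0 <= x <= T) [seq znorm R h | h <- s].
    apply/allP => x /mapP[h hs ->]; rewrite (allP sT)// andbT.
    by rewrite (le_trans a0rho)// (allP rs).
  move=> /(_ aT); rewrite big_map big_split/= sumrN Theta_a0.
  have -> : \sum_(h <- s) f T = n * f T.
    by rewrite big_const_seq count_predT iter_addr_0 mulr_natl.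
  by have := Theta_ge0 a0T rT; rewrite /f; lra.
have [N sN] : exists N : nat, forall h, h \in s -> znorm R h <= N%:R.
  exists (\sum_(h <- s) (Num.truncn (znorm R h)).+1)%N => h hs.
  rewrite (le_trans (ltW (truncnS_gt _)))// ler_nat (big_rem h)//= leq_addr//.
have hc : (tail_bound + n * (K%:R : R)^-1) @[K --> \oo] --> tail_bound + n * 0.
  by apply: cvgD; [exact: cvg_cst|apply: cvgM; [exact: cvg_cst|exact: cvg_natV0]].
rewrite mulr0 addr0 in hc.
apply: (ler_cvg_to (cvg_cst _) hc).
exists (N + (Num.truncn rho).+1)%N => // K /= NK.
have K1 : (1 <= K)%N by rewrite (leq_trans _ NK)// addnS.
apply: (@le_trans _ _ (tail_bound + n * f K%:R)).
  apply: key.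
    by rewrite (le_trans (ltW (truncnS_gt _)))// ler_nat (leq_trans _ NK)// leq_addl.
  apply/allP => h /sN /le_trans; apply; by rewrite ler_nat (leq_trans _ NK)// leq_addr.
rewrite /= lerD2l ler_wpM2l// /f -powR_inv1// ler_powR ?ler1n//.
by rewrite lerN2 ltW.
Qed.

Lemma tail_esum_le :
  (\esum_(h in [set h : 'rV[int]_d | (rho <= znorm R h)%R])
     (znorm R h `^ (- nu))%:E <= tail_bound%:E)%E.
Proof.
apply: ge_ereal_sup => _ [X [finX XS] <-].
rewrite fsbig_finite// sumEFin lee_fin; apply: tail_sum_le; first exact: fset_uniq.
by apply/allP => h; rewrite in_fset_set// inE => /XS.
Qed.

End TailSum.

(** * The constant B *)

Section BConst.
Variable R : realType.

(** The absolute value makes the power continuous on the whole line, so that continuity composes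
    without tracking signs; for [a = 0] it is the constant 1, as 0^0 = 1. *)
Lemma continuous_normr_powR (a : R) : 0 <= a -> continuous (fun w : R => `|w| `^ a).
Proof.
rewrite le_eqVlt => /predU1P[<-|a0] x.
  by rewrite (_ : (fun w : R => _) = cst 1); [exact: cvg_cst|apply/funext => w;
    rewrite powRr0].
have [->|x0] := eqVneq x 0; last first.
  apply: (@cvg_comp _ _ _ (fun w : R => `|w|) (fun w => w `^ a) _ (nbhs `|x|)).
    exact: norm_continuous.
  by apply: cvg_powR; rewrite normr_gt0.
rewrite /continuous_at normr0 powR0 ?gt_eqF//.
apply/cvgrPdist_lt => e e0.
have := @nbhs0_lt R R^o (e `^ a^-1) (powR_gt0 _ e0); apply: filterS => w we.
rewrite sub0r normrN ger0_norm ?powR_ge0//.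
have [->|w0] := eqVneq w 0; first by rewrite normr0 powR0 ?gt_eqF.
have -> : e = (e `^ a^-1) `^ a by rewrite -powRrM mulVf ?gt_eqF// powRr1// ltW.
by rewrite gt0_ltr_powR// ?nnegrE ?powR_ge0.
Qed.

Variables p n : R.
Hypotheses (n0 : 0 < n) (np : n <= p).

(** [b_fun] after cancelling u^(2n), possible as p >= n: this form is regular at u = 0. It
    degenerates at u = 1, which the symmetry u -> 1 - u avoids. *)
Let bc (x : R * R) : R :=
  2 * x.1 * (4 - x.1) * `|1 - x.2| `^ (2 * n) * `|1 - x.1 * x.2 + x.1 * x.2 ^+ 2| `^ p /
  ((`|1 - x.2| `^ (2 * n) + `|x.2| `^ (2 * n)) *
   (`|1 - x.2| `^ p + `|1 - x.2| `^ n * `|x.2| `^ (p - n)) ^+ 2).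

Let p0 : 0 < p. Proof. exact: lt_le_trans np. Qed.
Let pn0 : 0 <= p - n. Proof. by rewrite subr_ge0. Qed.

(** For z <= 4 the expression is at least 1 - 4 u (1 - u) = (1 - 2 u)^2. *)
Lemma one_sub_zu_ge0 (z u : R) : 0 <= z <= 4 -> 0 <= u <= 1 -> 0 <= 1 - z * u + z * u
  ^+ 2.
Proof.
move=> /andP[z0 z4] /andP[u0 u1].
have h : 0 <= (4 - z) * (u * (1 - u)).
  by rewrite mulr_ge0 ?subr_ge0// mulr_ge0 ?subr_ge0.
have := sqr_ge0 (1 - 2 * u); rewrite expr2 in h *; lra.
Qed.

Let bc_den_gt0 (u : R) : u < 1 ->
  0 < (`|1 - u| `^ (2 * n) + `|u| `^ (2 * n)) *
   (`|1 - u| `^ p + `|1 - u| `^ n * `|u| `^ (p - n)) ^+ 2.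
Proof.
move=> u1; have nu : 0 < `|1 - u| by rewrite normr_gt0 subr_eq0 gt_eqF.
by rewrite mulr_gt0 ?exprn_gt0// ltr_pwDl ?powR_gt0 ?powR_ge0// mulr_ge0 ?powR_ge0.
Qed.

Let bc_continuous (x : R * R) : x.2 < 1 -> {for x, continuous bc}.
Proof.
move=> x1.
have c1 : {for x, continuous (fun x : R * R => x.1)} by exact: cvg_fst.
have c2 : {for x, continuous (fun x : R * R => x.2)} by exact: cvg_snd.
have cc (c : R) : {for x, continuous (fun _ : R * R => c)} by exact: cvg_cst.
have cp (a : R) (f : R * R -> R) : 0 <= a -> {for x, continuous f} ->
    {for x, continuous (fun x => `|f x| `^ a)}.
  move=> a0 cf; apply: (@cvg_comp _ _ _ f (fun w => `|w| `^ a) _ (nbhs (f x))) => //.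
  exact: continuous_normr_powR.
have cD (f g : R * R -> R) : {for x, continuous f} -> {for x, continuous g} ->
    {for x, continuous (fun x => f x + g x)} by move=> cf cg; exact: cvgD.
have cB (f g : R * R -> R) : {for x, continuous f} -> {for x, continuous g} ->
    {for x, continuous (fun x => f x - g x)} by move=> cf cg; exact: cvgB.
have cM (f g : R * R -> R) : {for x, continuous f} -> {for x, continuous g} ->
    {for x, continuous (fun x => f x * g x)} by move=> cf cg; exact: cvgM.
have n2 : 0 <= 2 * n by rewrite mulr_ge0// ltW.
have cu := cp n _ (ltW n0) (cB _ _ (cc 1) c2).
have cu2 := cp (2 * n) _ n2 (cB _ _ (cc 1) c2).
have cup := cp p _ (ltW p0) (cB _ _ (cc 1) c2).
apply: (cM).
  apply: (cM); last first.
    apply: (cp); first exact: ltW.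
    by apply: (cD); [apply: (cB) => //; exact: cM|apply: (cM) => //; exact: cM].
  by apply: (cM) => //; apply: (cM); [exact: cM|exact: cB].
apply: cvgV; first by rewrite gt_eqF// bc_den_gt0.
have c3 := cp _ _ n2 c2; have c4 := cp _ _ pn0 c2.
have c5 := cD _ _ cup (cM _ _ cu c4).
by apply: (cM); [exact: cD|exact: cM].
Qed.

Let b_fun_bc (z u : R) : 0 <= z <= 4 -> 0 <= u < 1 -> b_fun p n z u = bc (z, u).
Proof.
move=> z4 /andP[u0 u1]; have n20 : 2 * n != 0 by rewrite mulf_neq0// gt_eqF.
rewrite /b_fun /bc /=; have [->|un0] := eqVneq u 0.
  rewrite /= !subr0 mulr0 subr0 expr0n/= mulr0 addr0 normr1 normr0.
  rewrite !powR1 powR0// !mulr1 !mul1r addr0 mul1r; congr (_ / _).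
  (* The boundary denominator 1 + 3 delta is (1 + delta)^2, where delta is the value of 0^(p -
     n). *)
  have -> : 0 `^ (p - n) = (p == n)%:R :> R by rewrite /powR eqxx subr_eq0.
  by case: eqP => _ /=; ring.
rewrite /= lt_eqF//.
have nu : 0 < 1 - u by rewrite subr_gt0.
have ugt0 : 0 < u by rewrite lt0r un0.
have u01 : 0 <= u <= 1 by rewrite u0 ltW.
rewrite !(gtr0_norm nu) (gtr0_norm ugt0) (ger0_norm (one_sub_zu_ge0 z4 u01)).
have -> : u `^ p = u `^ n * u `^ (p - n).
  by rewrite -powRD ?(addrC n) ?subrK// (gt_eqF ugt0) implybT.
have E2 (x : R) : x `^ (2 * n) = (x `^ n) ^+ 2.
  by rewrite mulrC powRrM -powR_mulrn ?powR_ge0.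
rewrite !E2.
have Xn : 0 < (1 - u) `^ n by rewrite powR_gt0.
have Xp : 0 < (1 - u) `^ p by rewrite powR_gt0.
have Upn : 0 < u `^ (p - n) by rewrite powR_gt0.
field.
have Un0 : 0 < u `^ n by rewrite powR_gt0.
apply/and3P; split.
- by rewrite gt_eqF// addr_gt0// mulr_gt0.
- by rewrite gt_eqF// addr_gt0// exprn_gt0.
- by rewrite gt_eqF// addr_gt0// !mulr_gt0.
Qed.

Let b_funC (z u : R) : b_fun p n z (1 - u) = b_fun p n z u.
Proof.
rewrite /b_fun.
have -> : (1 - u == 0) = (u == 1) by rewrite subr_eq0 eq_sym.
have -> : (1 - u == 1) = (u == 0) by rewrite -subr_eq0 addrAC subrr add0r oppr_eq0.
rewrite orbC; case: ifP => // _.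
have -> : 1 - (1 - u) = u by ring.
have -> : 1 - z * (1 - u) + z * (1 - u) ^+ 2 = 1 - z * u + z * u ^+ 2 by ring.
by congr (_ / _); ring.
Qed.

Lemma b_fun_le_B (z u : R) : 0 <= z <= 4 -> 0 <= u <= 1 ->
  b_fun p n z u <= B_const p n.
Proof.
move=> z4 u1.
apply: (@le_maximum_compact R (R * R)%type (`[0, 4]%classic `*` `[0, 1 / 2]%classic)
  bc).
- by apply: compact_setX; exact: segment_compact.
- apply: continuous_in_subspaceT => -[a b]; rewrite inE => -[/= _].
  rewrite in_itv/= => /andP[_ b1]; apply: bc_continuous => /=; lra.
- apply/seteqP; split => [_ [a + [b + <-]]|_ [[a b] [/= + +] <-]].
    rewrite /= !in_itv/= => a4 b1.
    have [b2|b2] := leP b (1 / 2).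
      exists (a, b); first by rewrite /= !in_itv/= a4 b2 andbT; case/andP: b1.
      by rewrite -b_fun_bc//; case/andP: b1 => -> _ /=; lra.
    exists (a, 1 - b).
      by split; rewrite /= in_itv//=; case/andP: b1 => _ b1; apply/andP; split; lra.
    by rewrite -b_fun_bc ?b_funC//; case/andP: b1 => _ b1; apply/andP; split; lra.
  rewrite !in_itv/= => a4 /andP[b0 b1].
  exists a; first by rewrite /= in_itv.
  exists b; first by rewrite /= in_itv/= b0; lra.
  by rewrite b_fun_bc// b0/=; lra.
- by exists z; rewrite /= ?in_itv//; exists u; rewrite /= ?in_itv.
Qed.

End BConst.

(** * The kernel *)

Lemma esumZ (R : realType) (T : choiceType) (S : set T) (c : R) (a : T -> R) :
  0 < c -> (\esum_(i in S) (c * a i)%:E = c%:E * \esum_(i in S) (a i)%:E)%E.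
Proof.
move=> c0.
(* The inequality for every positive factor, used with [c] and with [c^-1], gives both
   directions. *)
have le (c' : R) (b : T -> R) : 0 < c' ->
    (\esum_(i in S) (c' * b i)%:E <= c'%:E * \esum_(i in S) (b i)%:E)%E.
  move=> c'0; apply: ge_ereal_sup => _ [X [finX XS] <-].
  rewrite fsbig_finite// sumEFin -mulr_sumr EFinM lee_pmul2l ?lte_fin//.
  apply: ereal_sup_ubound; exists X; first by split.
  by rewrite fsbig_finite// sumEFin.
apply/eqP; rewrite eq_le le//=.
have := le c^-1 (fun i => c * a i); rewrite invr_gt0 => /(_ c0).
under eq_esum do rewrite mulKf ?gt_eqF//.
move=> h; rewrite -(@lee_pmul2l _ c^-1%:E) ?lte_fin ?invr_gt0//.
by rewrite muleA -EFinM mulVf ?gt_eqF// mul1e.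
Qed.

Section PowR.
Variable R : realType.

Lemma powR_sqr (x a : R) : x `^ (2 * a) = (x `^ a) ^+ 2.
Proof. by rewrite mulrC powRrM -powR_mulrn ?powR_ge0. Qed.

Lemma powR_div (x y a : R) : 0 < x -> 0 < y -> (x / y) `^ a = x `^ a / y `^ a.
Proof.
move=> x0 y0; rewrite powRM ?invr_ge0 ?ltW//; congr (_ * _).
by rewrite -powR_inv1 ?ltW// -powRrM mulN1r powRN.
Qed.

End PowR.

Section KernelTerm.
Variables (R : realType) (d : nat) (p n : R).
Hypotheses (n0 : 0 < n) (np : n <= p).
Implicit Types k h : 'rV[int]_d.

Definition kterm k h : R := Pnorm R h (k - h) ^+ 2 / weight p n k h.

Lemma weight_ge0 k h : 0 <= weight p n k h.
Proof. exact: sqr_ge0. Qed.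

Lemma weight_gt0 k h : h != 0 -> h != k -> 0 < weight p n k h.
Proof.
move=> h0 hk; have l0 : k - h != 0 by rewrite subr_eq0 eq_sym.
by rewrite exprn_gt0// addr_gt0// mulr_gt0// powR_gt0// znorm_gt0.
Qed.

Lemma kterm_ge0 k h : 0 <= kterm k h.
Proof. by rewrite divr_ge0 ?sqr_ge0. Qed.

(** Real powers are abstracted to positive atoms, leaving a rational identity; [T] and [Tp] stand
    for the powers n and p of |h| + |k - h|. *)
Let kterm_algebra (z Xn Xp Yn Yp Kp T Tp : R) :
  0 < Xn -> 0 < Xp -> 0 < Yn -> 0 < Yp -> 0 < T -> 0 < Tp ->
  4 * Kp ^+ 2 * (z * (4 - z) / 4 / (Xp * Yn + Xn * Yp) ^+ 2) =
  2 * z * (4 - z) * (Yn / T) ^+ 2 * (Xn / T) ^+ 2 * (Kp / Tp) ^+ 2 /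
  (((Yn / T) ^+ 2 + (Xn / T) ^+ 2) *
   (Yp / Tp * (Xn / T) + Yn / T * (Xp / Tp)) ^+ 2) / 2 *
  ((Xn ^+ 2)^-1 + (Yn ^+ 2)^-1).
Proof.
move=> Xn0 Xp0 Yn0 Yp0 T0 Tp0.
have -> : Yp / Tp * (Xn / T) + Yn / T * (Xp / Tp) = (Xp * Yn + Xn * Yp) / (Tp * T).
  by field; rewrite !gt_eqF.
have -> : (Yn / T) ^+ 2 + (Xn / T) ^+ 2 = (Xn ^+ 2 + Yn ^+ 2) / T ^+ 2.
  by field; rewrite !gt_eqF.
have -> : (Xn ^+ 2)^-1 + (Yn ^+ 2)^-1 = (Xn ^+ 2 + Yn ^+ 2) / (Xn * Yn) ^+ 2.
  by field; rewrite !gt_eqF.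
have : 0 < Xp * Yn + Xn * Yp by rewrite addr_gt0// mulr_gt0.
have : 0 < Xn ^+ 2 + Yn ^+ 2 by rewrite addr_gt0// exprn_gt0.
move: (Xp * Yn + Xn * Yp) (Xn ^+ 2 + Yn ^+ 2) => w v v0 w0.
by field; rewrite !gt_eqF.
Qed.

Lemma kterm_le k h : k != 0 -> h != 0 -> h != k ->
  4 * znorm R k `^ (2 * p) * kterm k h <=
  B_const p n / 2 * (znorm R h `^ (- (2 * n)) + znorm R (k - h) `^ (- (2 * n))).
Proof.
move=> k0 h0 hk; have l0 : k - h != 0 by rewrite subr_eq0 eq_sym.
have [_ Ps _] := Pnorm_prop R h0 l0.
set X := znorm R h; set Y := znorm R (k - h); set K := znorm R k.
have X0 : 0 < X by exact: znorm_gt0. have Y0 : 0 < Y by exact: znorm_gt0.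
have K0 : 0 < K by exact: znorm_gt0.
have S0 : 0 < X + Y by rewrite addr_gt0.
pose g := dot (rvec R h) (rvec R (k - h)).
pose z := 2 * (1 - g / (X * Y)); pose u := X / (X + Y).
have gXY : `|g| <= X * Y by exact: dot_le_norm2.
have z4 : 0 <= z <= 4.
  have : `|g / (X * Y)| <= 1.
    by rewrite normrM normfV (gtr0_norm (mulr_gt0 X0 Y0)) ler_pdivrMr ?mulr_gt0// mul1r.
  by rewrite ler_norml /z => /andP[h1 h2]; apply/andP; split; lra.
have u0 : 0 < u by rewrite divr_gt0.
have uE : 1 - u = Y / (X + Y) by rewrite /u; field; rewrite gt_eqF.
have u1 : u < 1 by rewrite -subr_gt0 uE divr_gt0.
have u01 : 0 <= u <= 1 by rewrite !ltW.
(* Law of cosines: |k|^2 = (X + Y)^2 - z X Y, divided by (X + Y)^2. *)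
have WE : 1 - z * u + z * u ^+ 2 = (K / (X + Y)) ^+ 2.
  have K2 : K ^+ 2 = X ^+ 2 + Y ^+ 2 + 2 * g.
    have kE : rvec R k = rvec R (k - h) + rvec R h by rewrite -rvecD subrK.
    have X2 : X ^+ 2 = dot (rvec R h) (rvec R h) := sqr_norm2 _.
    have Y2 : Y ^+ 2 = dot (rvec R (k - h)) (rvec R (k - h)) := sqr_norm2 _.
    have -> : K ^+ 2 = dot (rvec R k) (rvec R k) := sqr_norm2 _.
    rewrite X2 Y2 kE dotDl !dotDr /g (dotC (rvec R (k - h)) (rvec R h)).
    ring.
  by rewrite [RHS]expr_div_n K2 /u /z; field; rewrite !gt_eqF.
have sE : sin2 R h (k - h) = z * (4 - z) / 4.
  rewrite /sin2 /gram -/g -/X -/Y -!sqr_norm2 -/(znorm R h) -/(znorm R (k - h)) -/X -/Y.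
  by rewrite /z; field; rewrite !gt_eqF.
have hB := b_fun_le_B n0 np z4 u01.
have invs : X `^ (- (2 * n)) + Y `^ (- (2 * n)) =
    ((X `^ n) ^+ 2)^-1 + ((Y `^ n) ^+ 2)^-1 by rewrite !powRN !powR_sqr.
have A0 : 0 < X `^ n by rewrite powR_gt0. have Ap0 : 0 < X `^ p by rewrite powR_gt0.
have C0 : 0 < Y `^ n by rewrite powR_gt0. have Cp0 : 0 < Y `^ p by rewrite powR_gt0.
have T0 : 0 < (X + Y) `^ n by rewrite powR_gt0.
have Tp0 : 0 < (X + Y) `^ p by rewrite powR_gt0.
have Kp0 : 0 < K `^ p by rewrite powR_gt0.
have E : 4 * K `^ (2 * p) * (sin2 R h (k - h) / weight p n k h) =
    b_fun p n z u / 2 * (X `^ (- (2 * n)) + Y `^ (- (2 * n))).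
  have WP : ((K / (X + Y)) ^+ 2) `^ p = (K `^ p / (X + Y) `^ p) ^+ 2.
    by rewrite -powR_div// -powR_sqr -powR_mulrn ?divr_ge0 ?ltW// -powRrM.
  rewrite invs /b_fun gt_eqF//= lt_eqF//= /weight -/X -/Y sE WE uE !powR_sqr WP.
  rewrite /u !powR_div//.
  exact: kterm_algebra.
apply: (@le_trans _ _ (4 * K `^ (2 * p) * (sin2 R h (k - h) / weight p n k h))).
  rewrite ler_wpM2l ?mulr_ge0 ?powR_ge0// /kterm ler_wpM2r ?invr_ge0 ?weight_ge0//.
rewrite E ler_wpM2r ?addr_ge0 ?powR_ge0// ler_pM2r ?invr_gt0//.
Qed.

End KernelTerm.

(** * Near and far parts of the kernel sum *)

Section TailKernel.
Variables (R : realType) (d : nat) (p n rho : R).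
Hypotheses (d2 : (2 <= d)%N) (dn : d%:R / 2 < n) (np : n <= p).
Hypothesis hrho : 2 * Num.sqrt d%:R < rho.
Implicit Types k h : 'rV[int]_d.

Let n0 : 0 < n.
Proof. by apply: le_lt_trans dn; rewrite divr_ge0. Qed.

Let rho0 : 0 < rho.
Proof. by apply: le_lt_trans hrho; rewrite mulr_ge0 ?sqrtr_ge0. Qed.

Definition near_set k : set 'rV[int]_d :=
  [set h | Z0k k h /\ (znorm R h < rho \/ znorm R (k - h) < rho)].
Definition far_set k : set 'rV[int]_d :=
  [set h | [/\ Z0k k h, rho <= znorm R h & rho <= znorm R (k - h)]].

Lemma finite_ball : finite_set [set h : 'rV[int]_d | znorm R h < rho].
Proof. by apply: sub_finite_set (finite_zball d rho) => h /ltW. Qed.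

Lemma finite_near k : finite_set (near_set k).
Proof.
apply: (@sub_finite_set _ _ ([set h | znorm R h < rho] `|`
    ((fun h => k - h) @` [set h : 'rV[int]_d | znorm R h < rho]))).
  move=> h [_ [hr|hr]]; [by left|right].
  by exists (k - h) => //; rewrite opprB addrCA subrr addr0.
by rewrite finite_setU; split; [|apply: finite_image]; exact: finite_ball.
Qed.

Definition near_sum k : R := \sum_(h \in near_set k) kterm p n k h.

Lemma scrKE k : scrK p n rho k = 4 * znorm R k `^ (2 * p) * near_sum k.
Proof. by []. Qed.

Lemma calK_split k :
  (calK p n k = (scrK p n rho k)%:E +
    (4 * znorm R k `^ (2 * p))%:E * \esum_(h in far_set k) (kterm p n k h)%:E)%E.
Proof.
rewrite /calK (esumID (near_set k)); last first.
  by move=> h _; rewrite lee_fin kterm_ge0.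
have -> : Z0k k `&` near_set k = near_set k.
  by apply/seteqP; split => [h []//|h nh]; split => //; case: nh.
have -> : Z0k k `&` ~` near_set k = far_set k.
  apply/seteqP; split => h /=.
    move=> [zh nh]; split => //; rewrite leNgt; apply/negP => hr; apply: nh;
      split => //; [by left|by right].
  move=> [zh h1 h2]; split => // -[_ []]; by rewrite ltNge ?h1 ?h2.
rewrite ge0_muleDr; last 2 first.
- by apply: esum_ge0 => h _; rewrite lee_fin kterm_ge0.
- by apply: esum_ge0 => h _; rewrite lee_fin kterm_ge0.
congr (_ + _)%E; rewrite scrKE [RHS]EFinM /near_sum; congr (_ * _)%E.
rewrite -[near_set k]set_mem_set.
rewrite esum_fset; last by move=> h _; rewrite lee_fin kterm_ge0.
  by rewrite !fsbig_finite ?sumEFin//; rewrite set_mem_set; exact: finite_near.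
by rewrite set_mem_set; exact: finite_near.
Qed.

Lemma tail_boundE : B_const p n * tail_bound d (2 * n) rho = deltaK p n d rho.
Proof.
rewrite /tail_bound /deltaK /tail_coef mulrA; congr (_ * _).
by rewrite mulrC -!mulrA; congr (_ * _); congr (_ * _); rewrite mulrC.
Qed.

Lemma B_const_ge0 : 0 <= B_const p n.
Proof.
have h : 0 <= (0 : R) <= 4 by rewrite lexx/=.
have h1 : 0 <= (0 : R) <= 1 by rewrite lexx/=.
apply: le_trans (b_fun_le_B n0 np h h1).
by rewrite /b_fun eqxx/= mulr0 !mul0r.
Qed.

Let B_nu k : (\esum_(h in far_set k) (B_const p n / 2 * znorm R h `^ (- (2 * n)))%:E <=
  (B_const p n / 2 * tail_bound d (2 * n) rho)%:E)%E.
Proof.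
have dnu : d%:R < 2 * n by move: dn; lra.
have := B_const_ge0; rewrite le_eqVlt => /predU1P[<-|B0].
  by rewrite !mul0r esum1// => h _; rewrite !mul0r.
rewrite esumZ ?divr_gt0// [X in (_ <= X)%E]EFinM lee_pmul2l ?lte_fin ?divr_gt0//.
apply: le_trans (tail_esum_le d2 dnu hrho).
apply: ge_ereal_sup => _ [X [finX XS] <-].
apply: ereal_sup_ubound; exists X => //; split => // h /XS.
by case.
Qed.

(** The reflection h -> k - h maps [far_set k] onto itself, so the two terms of [kterm_le] have
    equal sums, which absorbs the factor 1/2. *)
Lemma far_esum_le k : k != 0 ->
  ((4 * znorm R k `^ (2 * p))%:E * (\esum_(h in far_set k) (kterm p n k h)%:E) <=
   (deltaK p n d rho)%:E)%E.
Proof.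
move=> k0; have kp : 0 < 4 * znorm R k `^ (2 * p).
  by rewrite mulr_gt0// powR_gt0// znorm_gt0.
rewrite -esumZ//.
apply: (@le_trans _ _ (\esum_(h in far_set k)
   ((B_const p n / 2 * znorm R h `^ (- (2 * n)))%:E +
    (B_const p n / 2 * znorm R (k - h) `^ (- (2 * n)))%:E))%E).
  apply: le_esum => h [[h0 hk] _ _]; rewrite -EFinD lee_fin -mulrDr.
  exact: kterm_le.
have B20 : 0 <= B_const p n / 2 by rewrite divr_ge0// B_const_ge0.
rewrite esumD; last 2 first.
- by move=> h _; rewrite lee_fin mulr_ge0 ?powR_ge0.
- by move=> h _; rewrite lee_fin mulr_ge0 ?powR_ge0.
have -> : (\esum_(h in far_set k) (B_const p n / 2 * znorm R (k - h) `^ (- (2 *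
  n)))%:E =
  \esum_(h in far_set k) (B_const p n / 2 * znorm R h `^ (- (2 * n)))%:E)%E.
  rewrite [RHS](@reindex_esum _ _ _ (far_set k) (far_set k) (fun h => k - h))//.
  have farK h : far_set k h -> far_set k (k - h).
    move=> [[h0 hk] h1 h2]; split.
    - by split; rewrite ?subr_eq0 1?eq_sym// -subr_eq0 opprB addrCA subrr addr0.
    - by [].
    - by rewrite opprB addrCA subrr addr0.
  split.
  - by move=> h; exact: farK.
  - by move=> h h' _ _ /addrI/oppr_inj.
  - move=> h fh; exists (k - h); first exact: farK.
    by rewrite opprB addrCA subrr addr0.
have -> : deltaK p n d rho = B_const p n / 2 * tail_bound d (2 * n) rho +
    B_const p n / 2 * tail_bound d (2 * n) rho by rewrite -tail_boundE; field.
by rewrite EFinD leeD.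
Qed.

(** Since d >= 2, there is an index j other than some i with k_i nonzero; then e_j is not parallel
    to k, which keeps the Gram determinant positive. *)
Lemma far_kterm_gt0 k : k != 0 -> exists2 h, far_set k h & 0 < kterm p n k h.
Proof.
move=> k0; have [i ki] : exists i, k 0 i != 0.
  apply/existsP; apply: contraNT k0; rewrite negb_exists => /forallP h.
  by apply/eqP/rowP => i; rewrite mxE; have := h i; rewrite negbK => /eqP.
have [j ji] : exists j : 'I_d, j != i.
  have [i0|i0] := eqVneq (i : nat) 0%N.
    by exists (Ordinal d2); rewrite -val_eqE /= i0.
  by exists (Ordinal (ltnW d2)); rewrite -val_eqE /= eq_sym.
pose e : 'rV[int]_d := delta_mx 0 j.
pose x := rvec R k; pose y := rvec R e.
have ye : y = delta_mx 0 j by apply/rowP => r; rewrite !mxE rmorph_nat.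
have yy : dot y y = 1 by rewrite ye dot_delta mxE !eqxx.
have xy : dot x y = (k 0 j)%:~R by rewrite ye dot_delta mxE.
have x1 : 1 <= znorm R k.
  apply: le_trans (coord_le_znorm R k i); rewrite -intr_norm.
  by rewrite -[leLHS]/(1%:~R) ler_int; move: ki; lia.
(* As |k| >= 1, this N makes N |k| - 1 and (N - 1) |k| - 1 at least [rho], and N |k|^2 + k_j
   positive. *)
pose N : int := (Num.truncn (rho + 2 * znorm R k + 2)).+1.
have hN : rho + 2 * znorm R k + 2 < N%:~R by exact: truncnS_gt.
have N1 : 1 <= N%:~R :> R by rewrite -[leLHS]/(1%:~R) ler_int.
pose l := N *: k + e.
have lE : rvec R l = N%:~R *: x + y.
  by rewrite rvecD; congr (_ + _); apply/rowP => r; rewrite !mxE rmorphM.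
have hE : rvec R (k - l) = x - rvec R l by exact: rvecB.
have ny : norm2 y = 1 by rewrite /norm2 yy sqrtr1.
have x0 : 0 <= norm2 x by exact: norm2_ge0.
have rl : rho <= znorm R l.
  rewrite /znorm lE -[y]opprK; apply: le_trans (ler_norm2B _ _).
  rewrite norm2N ny norm2Z ger0_norm; last by rewrite (le_trans _ N1).
  have : N%:~R * 1 <= N%:~R * norm2 x by rewrite ler_wpM2l// (le_trans _ N1).
  by move: hN x1; rewrite /znorm -/x; lra.
have rh : rho <= znorm R (k - l).
  rewrite /znorm hE lE (_ : _ - _ = - ((N%:~R - 1) *: x - (- y))); last first.
    by apply/rowP => r; rewrite !mxE; ring.
  rewrite norm2N; apply: le_trans (ler_norm2B _ _).
  rewrite norm2N ny norm2Z ger0_norm ?subr_ge0//.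
  have : (N%:~R - 1) * 1 <= (N%:~R - 1) * norm2 x by rewrite ler_wpM2l// subr_ge0.
  by move: hN x1; rewrite /znorm -/x; lra.
have l0 : l != 0.
  by rewrite -(rvec_eq0 R); apply: contraTneq rl => lz;
    rewrite -ltNge /znorm lz /norm2 (eqP (_ : dot 0 0 == 0)) ?dot_eq0// sqrtr0.
have h0 : k - l != 0.
  by rewrite -(rvec_eq0 R); apply: contraTneq rh => lz;
    rewrite -ltNge /znorm lz /norm2 (eqP (_ : dot 0 0 == 0)) ?dot_eq0// sqrtr0.
have hl : k - (k - l) = l by rewrite opprB addrCA subrr addr0.
have hk : k - l != k by rewrite -subr_eq0 addrAC subrr add0r oppr_eq0.
exists (k - l); first by split; rewrite ?hl.
rewrite /kterm hl divr_gt0 ?weight_gt0//; apply: Pnorm_sqr_gt0; rewrite ?subrK//.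
(* The Gram determinant equals that of k and e_j, namely |k|^2 - k_j^2, which is at least k_i^2. *)
- rewrite /gram hE; set L := rvec R l.
  have -> : dot (x - L) (x - L) * dot L L - dot (x - L) L ^+ 2 =
      dot x x - (k 0 j)%:~R ^+ 2.
    rewrite !dotBl !dotBr (dotC L x) /L lE !(dotDl, dotDr, dotZl, dotZr) (dotC y x)
      yy xy.
    ring.
  rewrite dot_rvec (bigD1 j)//= addrAC subrr add0r (bigD1 i) 1?eq_sym//= ltr_wpDr//.
    by apply: sumr_ge0 => r _; exact: sqr_ge0.
  by rewrite lt0r sqr_ge0 sqrf_eq0 intr_eq0 ki.
- rewrite -/x lE dotDr dotZr xy gt_eqF//.
  have kj : `|(k 0 j)%:~R : R| <= norm2 x by exact: coord_le_znorm.
  have := ler_norm (- ((k 0 j)%:~R : R)); rewrite normrN => kj'.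
  have h1 : 2 * norm2 x <= N%:~R * dot x x.
    rewrite -sqr_norm2 expr2 mulrA ler_wpM2r//.
    apply: (@le_trans _ _ (N%:~R * 1)); first by move: hN; rewrite mulr1 /znorm -/x;
      move: rho0 x0; lra.
    by rewrite ler_wpM2l// (le_trans _ N1).
  by move: x1; rewrite /znorm -/x; lra.
Qed.

End TailKernel.

(** * Symmetries and reindexing of the near part *)

(* Stated over variable index sets, so that rewriting with them never unfolds
   concrete ones such as [near_set]. *)
Section RealFsums.
Variables (R : realType) (T : choiceType).
Implicit Types (A B : set T) (F G : T -> R).

Lemma fsumr_finite A F : finite_set A ->
  \sum_(i \in A) F i = \sum_(i <- fset_set A) F i.
Proof. exact: fsbig_finite. Qed.

Lemma fsumr_mkcondr A B F :
  \sum_(i \in A `&` B) F i = \sum_(i \in A) if i \in B then F i else 0.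
Proof. exact: fsbig_mkcondr. Qed.

Lemma fsumrU A B F : finite_set A -> finite_set B -> A `&` B `<=` set0 ->
  \sum_(i \in A `|` B) F i = \sum_(i \in A) F i + \sum_(i \in B) F i.
Proof. exact: fsbigU0. Qed.

Lemma fsumr_split A F G : finite_set A ->
  \sum_(i \in A) F i + \sum_(i \in A) G i = \sum_(i \in A) (F i + G i).
Proof. by move=> fA; rewrite !fsumr_finite// big_split. Qed.

Lemma ler_fsumr A F G : finite_set A -> (forall i, A i -> F i <= G i) ->
  \sum_(i \in A) F i <= \sum_(i \in A) G i.
Proof.
move=> fA FG; rewrite !fsumr_finite// big_seq [leRHS]big_seq.
by apply: ler_sum => i; rewrite in_fset_set// inE => /FG.
Qed.

Lemma eq_fsumr A F G : (forall i, A i -> F i = G i) ->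
  \sum_(i \in A) F i = \sum_(i \in A) G i.
Proof. by move=> FG; apply: eq_fsbigr => i; rewrite inE => /FG. Qed.

Lemma mulr_sum_fset A F c : finite_set A ->
  c * \sum_(i \in A) F i = \sum_(i \in A) c * F i.
Proof. by move=> fA; rewrite !fsumr_finite// mulr_sumr. Qed.

Lemma fsumrU_reindex A B B' (e : T -> T) F :
  finite_set A -> finite_set B -> A `&` B `<=` set0 ->
  set_bij (A `&` B') B e ->
  \sum_(i \in A `|` B) F i =
  \sum_(i \in A) (F i + if i \in B' then F (e i) else 0).
Proof.
move=> fA fB AB bij; rewrite fsumrU// -fsumr_split//; congr (_ + _).
rewrite -fsumr_mkcondr; exact: reindex_fsbig bij.
Qed.

End RealFsums.

Section Symmetry.
Variables (R : realType) (d : nat) (p n rho : R).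
Implicit Types k h : 'rV[int]_d.

(** Covers reflections and permutations at once: right multiplication by [M] preserves norms and
    [Pnorm] and matches the two near sets term by term. *)
Lemma scrK_orthogonal (M : 'M[int]_d) k : M *m M^T = 1%:M ->
  scrK p n rho (k *m M) = scrK p n rho k.
Proof.
move=> MM; have MM' : M^T *m M = 1%:M by rewrite mulmx1C.
have Z h : znorm R (h *m M) = znorm R h by exact: znorm_orthogonal.
have nearM h k' : near_set rho k' h -> near_set rho (k' *m M) (h *m M).
  move=> [[h0 hk] hr]; split; last by rewrite -mulmxBl !Z.
  split; first by apply: contraNneq h0 => /(congr1 (mulmx^~ M^T));
    rewrite -mulmxA MM mulmx1 mul0mx => ->.
  by apply: contraNneq hk => /(congr1 (mulmx^~ M^T)); rewrite -!mulmxA MM !mulmx1 => ->.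
have bij : set_bij (near_set rho k) (near_set rho (k *m M)) (fun h => h *m M).
  split.
  - by move=> h; exact: nearM.
  - by move=> h h' _ _ /(congr1 (mulmx^~ M^T)); rewrite -!mulmxA MM !mulmx1.
  - move=> h nh; exists (h *m M^T); last by rewrite -mulmxA MM' mulmx1.
    case: nh => [[h0 hk] hr].
    have E : h = (h *m M^T) *m M by rewrite -mulmxA MM' mulmx1.
    split; last by move: hr; rewrite {1 2}E -mulmxBl !Z.
    split; first by apply: contraNneq h0 => hz; rewrite E hz mul0mx.
    by apply: contraNneq hk => hz; rewrite E hz.
have kE h : kterm p n (k *m M) (h *m M) = kterm p n k h :> R.
  have kh : k *m M - h *m M = (k - h) *m M by rewrite mulmxBl.
  rewrite /kterm /weight kh.
  rewrite (Pnorm_orthogonal R h (k - h) MM).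
  by rewrite (Z h) (Z (k - h)).
suff E : near_sum p n rho (k *m M) = near_sum p n rho k by rewrite !scrKE E (Z k).
rewrite /near_sum.
transitivity (\sum_(h \in near_set rho k) kterm p n (k *m M) (h *m M) : R).
  exact: reindex_fsbig bij.
by apply: eq_fsbigr => h _; exact: kE.
Qed.

Lemma scrK_reflect (r : 'I_d) k : scrK p n rho (reflect_coord r k) = scrK p n rho k.
Proof.
pose e : 'rV[int]_d := \row_i (if i == r then -1 else 1).
have -> : reflect_coord r k = k *m diag_mx e.
  apply/rowP => i; rewrite mul_mx_diag !mxE; case: ifP => _; ring.
apply: scrK_orthogonal; rewrite tr_diag_mx mulmx_diag.
apply/matrixP => i j; rewrite !mxE; case: ifP => // _; case: ifP => //.
Qed.

Lemma scrK_permute (s : 'S_d) k : scrK p n rho (permute_coord s k) = scrK p n rho k.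
Proof.
rewrite /permute_coord col_permE; apply: scrK_orthogonal.
by rewrite tr_perm_mx -perm_mxM mulgV perm_mx1.
Qed.

End Symmetry.

Section Heaviside.
Variables (R : realType) (d : nat) (p n rho : R).
Implicit Types k h : 'rV[int]_d.

Lemma weightC k h : weight p n k (k - h) = weight p n k h :> R.
Proof.
have E : k - (k - h) = h := subKr k h.
have H (a b c e : R) : (a * b + c * e) ^+ 2 = (e * c + b * a) ^+ 2 by ring.
rewrite /weight E; exact: H.
Qed.

Definition punctured_ball k : set 'rV[int]_d := [set h | Z0k k h /\ znorm R h < rho].

Lemma finite_punctured_ball k : finite_set (punctured_ball k).
Proof. by apply: sub_finite_set (finite_ball d rho) => h []. Qed.

(** The near points with |h| >= rho are the images under h -> k - h of the punctured-ball points
    with |k - h| >= rho. The weight is invariant under this reflection, and the Heaviside factor is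
    the indicator of the condition. *)
Lemma scrK_heaviside k : scrK p n rho k =
  4 * znorm R k `^ (2 * p) *
  \sum_(h \in punctured_ball k)
    ((Pnorm R h (k - h) ^+ 2
      + heaviside (znorm R (k - h) - rho) * Pnorm R (k - h) h ^+ 2)
     / weight p n k h).
Proof.
have subK h : k - (k - h) = h by exact: subKr.
rewrite scrKE.
set rhs := \sum_(h \in punctured_ball k) _.
suff -> : near_sum p n rho k = rhs by [].
rewrite /near_sum /rhs {rhs}.
pose out := [set h | Z0k k h /\ rho <= znorm R h /\ znorm R (k - h) < rho].
have nearE : near_set rho k = punctured_ball k `|` out.
  apply/seteqP; split => h /=.
    move=> [z hr]; have [h1|h1] := ltP (znorm R h) rho; first by left.
    by right; split => //; split => //; case: hr => //; rewrite ltNge h1.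
  by move=> [[z hr]|[z [h1 h2]]]; split => //; [left|right].
have fb := finite_punctured_ball k.
have fo : finite_set out.
  by apply: sub_finite_set (finite_near rho k) => h [z [_ h2]]; split => //; right.
have disj : punctured_ball k `&` out `<=` set0.
  by move=> h [[_ h1] [_ [h2 _]]]; move: h1; rewrite ltNge h2.
pose out' := [set h | rho <= znorm R (k - h)].
have bij : set_bij (punctured_ball k `&` out') out (fun h => k - h).
  split.
  - move=> h [[[h0 hk] h1] h2]; split; last by rewrite subK.
    by split; [rewrite subr_eq0 eq_sym|rewrite -subr_eq0 addrAC subrr add0r oppr_eq0].
  - by move=> h h' _ _ /addrI/oppr_inj.
  - move=> h [[h0 hk] [h1 h2]]; exists (k - h); last exact: subK.
    split; last by rewrite /out'/= subK.
    split => //.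
    by split; [rewrite subr_eq0 eq_sym|rewrite -subr_eq0 addrAC subrr add0r oppr_eq0].
rewrite nearE; apply: (etrans (fsumrU_reindex _ fb fo disj bij)).
apply: eq_fsumr => h _.
rewrite [RHS]mulrDl; congr (_ + _).
rewrite /heaviside subr_lt0 /kterm subK weightC.
have [h1|h1] := ltP (znorm R (k - h)) rho.
  by rewrite mul0r mul0r ifF//; apply/negP; rewrite inE /out'/= leNgt h1.
by rewrite ifT ?mul1r// inE.
Qed.

Lemma scrK_large k : 0 < rho -> 2 * rho <= znorm R k -> scrK p n rho k =
  4 * znorm R k `^ (2 * p) *
  \sum_(h \in [set h | Z0 h /\ znorm R h < rho])
    ((Pnorm R h (k - h) ^+ 2 + 1 * Pnorm R (k - h) h ^+ 2) / weight p n k h).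
Proof.
move=> rho0 kr; rewrite scrK_heaviside; congr (_ * _).
have -> : [set h | Z0 h /\ znorm R h < rho] = punctured_ball k.
  apply/seteqP; split => h [h0 hr]; split => //; last by case: h0.
  by split => //; apply: contraTneq hr => ->; rewrite -leNgt; lra.
apply: eq_fsbigr => h /set_mem[_ hr]; rewrite /heaviside ifF//.
apply/negP; have := ler_norm2B (rvec R k) (rvec R h).
by rewrite -rvecB -/(znorm R k) -/(znorm R h) -/(znorm R (k - h)); lra.
Qed.

End Heaviside.

(** * Expansion of the near part *)

Section EBound.
Variables (R : realType) (d : nat) (p n rho : R).
Implicit Types k h : 'rV[int]_d.

Lemma cos_angle (x y : 'rV[R]_d) : x != 0 -> y != 0 ->
  cos (angle x y) = dot x y / (norm2 x * norm2 y) /\ -1 <= cos (angle x y) <= 1.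
Proof.
move=> x0 y0; have xy : 0 < norm2 x * norm2 y by rewrite mulr_gt0// norm2_gt0.
have h : dot x y / (norm2 x * norm2 y) \in `[-1, 1].
  rewrite in_itv/= -ler_norml normrM normfV (gtr0_norm xy) ler_pdivrMr// mul1r.
  exact: dot_le_norm2.
by rewrite /angle acosK//; split => //; move: h; rewrite in_itv.
Qed.

Let E_term_algebra (c X Y K Xn Xp Yn Yp Kn Kp : R) :
  0 < X -> 0 < Y -> 0 < K -> 0 < Xn -> 0 < Xp -> 0 < Yn -> 0 < Yp -> 0 < Kn -> 0 < Kp ->
  4 * Kp ^+ 2 * (2 * (K ^+ 2 * c / Y ^+ 2) / (Xp * Yn + Xn * Yp) ^+ 2) =
  8 * (1 / Xn ^+ 2 *
    (c / (Yp * Y / (Kp * K) + Xp / Xn / (Kp / Kn) * (Yn * Y / (Kn * K))) ^+ 2)).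
Proof.
move=> X0 Y0 K0 Xn0 Xp0 Yn0 Yp0 Kn0 Kp0.
have -> : Yp * Y / (Kp * K) + Xp / Xn / (Kp / Kn) * (Yn * Y / (Kn * K))
   = Y * (Xp * Yn + Xn * Yp) / (K * Kp * Xn).
  by field; rewrite !gt_eqF.
have : 0 < Xp * Yn + Xn * Yp by rewrite addr_gt0// mulr_gt0.
by move: (Xp * Yn + Xn * Yp) => w w0; field; rewrite !gt_eqF.
Qed.

(** In the triangle 0, h, k, the law of cosines makes 1 - 2 c xi + xi^2 the square of |k - h| / |k|,
    and the law of sines passes from the angle between h and k - h to that between h and k. The
    factor |k - h|^(-2) from the sines accounts for the 1/2 in the exponents of [E_fun]. *)
Lemma E_term k h : k != 0 -> h != 0 -> h != k ->
  4 * znorm R k `^ (2 * p) * (2 * sin2 R h (k - h) / weight p n k h) =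
  8 * (1 / znorm R h `^ (2 * n) *
    E_fun p n (cos (angle (rvec R h) (rvec R k))) (znorm R h / znorm R k)).
Proof.
move=> k0 h0 hk; have l0 : k - h != 0 by rewrite subr_eq0 eq_sym.
have rh0 : rvec R h != 0 by rewrite rvec_eq0.
have rk0 : rvec R k != 0 by rewrite rvec_eq0.
have [-> _] := cos_angle rh0 rk0.
rewrite -/(znorm R h) -/(znorm R k).
set X := znorm R h; set Y := znorm R (k - h); set K := znorm R k.
have X0 : 0 < X by exact: znorm_gt0. have Y0 : 0 < Y by exact: znorm_gt0.
have K0 : 0 < K by exact: znorm_gt0.
set g := dot (rvec R h) (rvec R k).
have X2 : dot (rvec R h) (rvec R h) = X ^+ 2 by rewrite sqr_norm2.
have K2 : dot (rvec R k) (rvec R k) = K ^+ 2 by rewrite sqr_norm2.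
have Y2 : Y ^+ 2 = K ^+ 2 - 2 * g + X ^+ 2.
  rewrite -X2 -K2 sqr_norm2 rvecB dotBl !dotBr (dotC (rvec R k) (rvec R h)) -/g.
  ring.
have qE : 1 - 2 * (g / (X * K)) * (X / K) + (X / K) ^+ 2 = (Y / K) ^+ 2.
  by rewrite [RHS]expr_div_n Y2; field; rewrite !gt_eqF.
have sE : sin2 R h (k - h) = K ^+ 2 * (1 - (g / (X * K)) ^+ 2) / Y ^+ 2.
  rewrite /sin2 /gram -/X -/Y -(sqr_norm2 (rvec R (k - h))) -/(znorm R (k - h)) -/Y.
  rewrite X2 Y2 rvecB dotBr -/g X2; field.
  by rewrite -Y2 sqrf_eq0 !gt_eqF.
have qp (a : R) : ((Y / K) ^+ 2) `^ (a / 2 + 1 / 2) = Y `^ a * Y / (K `^ a * K).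
  rewrite -powR_mulrn ?divr_ge0 ?ltW// -powRrM.
  have -> : 2%:R * (a / 2 + 1 / 2) = a + 1 by field.
  rewrite powR_div// !powRD ?(gt_eqF Y0) ?(gt_eqF K0) ?implybT// !powRr1 ?ltW//.
rewrite /E_fun qE !qp sE /weight -/X -/Y !powR_sqr powR_div//.
have An0 : 0 < X `^ n by rewrite powR_gt0. have Ap0 : 0 < X `^ p by rewrite powR_gt0.
have Cn0 : 0 < Y `^ n by rewrite powR_gt0. have Cp0 : 0 < Y `^ p by rewrite powR_gt0.
have Kn0 : 0 < K `^ n by rewrite powR_gt0. have Kp0 : 0 < K `^ p by rewrite powR_gt0.
rewrite !powRB ?(gt_eqF X0) ?(gt_eqF K0) ?implybT//.
exact: E_term_algebra.
Qed.

(** Both [Pnorm] terms are bounded by the same squared sine and the Heaviside factor by 1, which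
    doubles the constant 4. *)
Lemma scrK_le_E k : 0 < rho -> k != 0 -> scrK p n rho k <=
  8 * \sum_(h \in punctured_ball rho k)
    (1 / znorm R h `^ (2 * n) *
      E_fun p n (cos (angle (rvec R h) (rvec R k))) (znorm R h / znorm R k)).
Proof.
move=> rho0 k0; have fb := @finite_punctured_ball R d rho k.
rewrite scrK_heaviside (mulr_sum_fset _ _ fb) (mulr_sum_fset _ _ fb).
apply: ler_fsumr => // h [[h0 hk] _].
have l0 : k - h != 0 by rewrite subr_eq0 eq_sym.
rewrite -E_term// ler_wpM2l ?mulr_ge0 ?powR_ge0//.
rewrite ler_wpM2r ?invr_ge0 ?weight_ge0//.
have [_ P1 _] := Pnorm_prop R h0 l0; have [_ P2 _] := Pnorm_prop R l0 h0.
have sC : sin2 R (k - h) h = sin2 R h (k - h).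
  rewrite /sin2 /gram (dotC (rvec R (k - h)) (rvec R h)).
  by congr (_ / _); [congr (_ - _)|]; rewrite mulrC.
rewrite sC in P2; rewrite mulr_natl mulr2n lerD//.
by rewrite /heaviside; case: ifP => _; rewrite ?mul0r ?mul1r// sin2_ge0.
Qed.

End EBound.

(** * Continuity and compactness on the sphere *)

Section Sphere.
Variables (R : realType) (d : nat).

Lemma continuous_bigsum (T : topologicalType) (I : Type) (r : seq I)
    (f : I -> T -> R) (x : T) :
  (forall i, {for x, continuous (f i)}) ->
  {for x, continuous (fun y => \sum_(i <- r) f i y)}.
Proof.
move=> cf; elim: r => [|i r ih].
  by rewrite (_ : (fun y => _) = cst 0); [exact: cvg_cst|apply/funext => y;
    rewrite big_nil].
rewrite (_ : (fun y => _) = (fun y => f i y + \sum_(j <- r) f j y)); last first.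
  by apply/funext => y; rewrite big_cons.
by apply: cvgD; [exact: cf|exact: ih].
Qed.

Lemma continuous_dot (a x : 'rV[R]_d) : {for x, continuous (fun u : 'rV[R]_d =>
  dot a u)}.
Proof.
apply: continuous_bigsum => i.
have c1 : {for x, continuous (fun _ : 'rV[R]_d => a 0 i)} by exact: cst_continuous.
have c2 : {for x, continuous (fun u : 'rV[R]_d => u 0 i)} by exact: coord_continuous.
exact: (cvgM c1 c2).
Qed.

Lemma compact_sphere : compact (@sphere R d).
Proof.
have E : @sphere R d = (fun u : 'rV[R]_d => dot u u) @^-1` [set 1].
  apply/seteqP; split => u /=; rewrite /sphere/= /norm2.
    by move=> h; rewrite -(sqr_norm2 u) /norm2 h expr1n.
  by move=> ->; rewrite sqrtr1.
apply: bounded_closed_compact.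
  exists 1; split => // M M1 u /= hu; rewrite [leLHS]/Num.norm/= mx_normrE.
  apply: bigmax_le => [|[i j] _ /=]; first by rewrite ltW// (lt_trans _ M1).
  rewrite ord1 (le_trans _ (ltW M1))// -hu -(@ler_pXn2r _ 2)// ?nnegrE ?norm2_ge0//.
  rewrite real_normK ?num_real// sqr_norm2 /dot (bigD1 j)//= expr2 lerDl.
  by apply: sumr_ge0 => r _; rewrite -expr2 sqr_ge0.
rewrite E; apply: (@closed_comp _ _ (fun u : 'rV[R]_d => dot u u) [set 1]);
  last exact: closed_eq.
move=> u _; apply: continuous_bigsum => i.
have cu : {for u, continuous (fun u : 'rV[R]_d => u 0 i)} by exact: coord_continuous.
exact: (cvgM cu cu).
Qed.

End Sphere.

(** * Termwise expansion for large |k| *)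

Section Expansion.
Variables (R : realType) (d : nat) (p n rho mu : R) (m : nat).
Variables (gamma : nat -> R) (Q : nat -> R -> R) (S : nat -> R * R -> R).
Hypotheses (np : n <= p) (rho0 : 0 < rho) (mu1 : 1 < mu).
Hypothesis hgamma : is_exponent_enum p n gamma.
Hypothesis hQS : is_expansion p n gamma Q S.
Implicit Types k h : 'rV[int]_d.

Let mu0 : 0 < mu. Proof. exact: lt_trans mu1. Qed.

Definition zball0 : set 'rV[int]_d := [set h | Z0 h /\ znorm R h < rho].

Lemma finite_zball0 : finite_set zball0.
Proof. by apply: sub_finite_set (finite_ball d rho) => h []. Qed.

Lemma exponent_ge0 j : 0 <= gamma j.
Proof.
have [_ hr] := hgamma.
have : range gamma (gamma j) by exists j.
rewrite hr => -[r _ [s _ <-]].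
by rewrite addr_ge0// mulr_ge0// subr_ge0.
Qed.

Lemma coef_poly : exists q : nat -> {poly R},
  forall j c, -1 <= c <= 1 -> Q j c = (q j).[c].
Proof.
have [_ hq _ _] := hQS.
by have /choice[q hq'] := hq; exists q.
Qed.

(** On the sphere the cosine cancels the arccosine, and its value lies in [-1, 1], where [Q j] is a
    polynomial. This form yields both [calQ_mpoly] and the continuity behind [frakK]. *)
Lemma calQ_sphereE (q : nat -> {poly R}) j (u : 'rV[R]_d) :
  (forall j c, -1 <= c <= 1 -> Q j c = (q j).[c]) -> sphere u ->
  calQ n rho gamma Q j u = \sum_(h <- fset_set zball0)
    (q j).[dot (rvec R h) u / znorm R h] / znorm R h `^ (2 * n - gamma j).
Proof.
move=> hq su; rewrite /calQ -/zball0 (fsumr_finite _ finite_zball0).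
rewrite big_seq [RHS]big_seq; apply: eq_bigr => h.
rewrite in_fset_set ?inE => [[h0 _]|]; last exact: finite_zball0.
have u0 : u != 0.
  apply/eqP => uz; move: su; rewrite /sphere/= uz /norm2 (eqP (_ :
    dot 0 0 == 0)) ?dot_eq0//.
  by rewrite sqrtr0 => /eqP; rewrite eq_sym oner_eq0.
have rh0 : rvec R h != 0 by rewrite rvec_eq0.
have [E hc] := cos_angle rh0 u0.
by rewrite hq// E su mulr1.
Qed.

Lemma calQ_mpoly j : exists q : mpoly.mpoly d R, forall u : 'rV[R]_d,
  sphere u -> calQ n rho gamma Q j u = mpoly.meval (fun i => u 0 i) q.
Proof.
have [q hq] := coef_poly.
pose lin h : mpoly.mpoly d R :=
  \sum_(r < d) (rvec R h 0 r / znorm R h) *: mpoly.mpolyX R (mpoly.mnm1 r).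
exists (\sum_(h <- fset_set zball0) (znorm R h `^ (2 * n - gamma j))^-1 *:
   (\sum_(i < size (q j)) (q j)`_i *: lin h ^+ i)).
move=> u su; rewrite (calQ_sphereE j hq su) raddf_sum; apply: eq_bigr => h _ /=.
rewrite mpoly.mevalZ mulrC; congr (_ * _).
rewrite horner_coef raddf_sum; apply: eq_bigr => i _ /=.
rewrite mpoly.mevalZ; congr (_ * _); rewrite rmorphXn/=; congr (_ ^+ _).
rewrite /lin raddf_sum /dot mulr_suml; apply: eq_bigr => r _ /=.
by rewrite mpoly.mevalZ mpoly.mevalXU mulrAC.
Qed.

(** Since xi <= 1 / mu < 1, the compact rectangle avoids (1, 1) and lies in [Edom], where [S m.+1]
    is continuous. *)
Lemma V_const_ge (c xi : R) : -1 <= c <= 1 -> 0 <= xi <= 1 / mu ->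
  S m.+1 (c, xi) <= V_const mu m S.
Proof.
move=> hc hxi; have [_ _ cS _] := hQS.
apply: (@le_maximum_compact R (R * R)%type (`[-1, 1]%classic `*` `[0, 1 /
  mu]%classic) (S m.+1)).
- by apply: compact_setX; exact: segment_compact.
- apply: continuous_subspaceW (cS m.+1 isT) => -[a b] [/= a1 b1].
  move: a1 b1; rewrite !in_itv/= => a1 /andP[b0 b1]; split => //=.
  move=> [_ bE]; move: b1; rewrite bE leNgt => /negP; apply.
  by rewrite ltr_pdivrMr// mul1r.
- apply/seteqP; split => [_ [a a1 [b b1 <-]]|_ [[a b] [/= a1 b1] <-]].
    by exists (a, b).
  by exists a => //; exists b.
- by exists c; rewrite /= ?in_itv//; exists xi; rewrite /= ?in_itv.
Qed.

Lemma angleZ (t : R) (x y : 'rV[R]_d) : 0 < t -> angle x (t *: y) = angle x y.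
Proof.
move=> t0; rewrite /angle dotZr norm2Z gtr0_norm// (mulrCA (norm2 x)).
by rewrite invfM mulrACA divff ?gt_eqF// mul1r.
Qed.

(** Putting xi = |h| / |k| in the expansion of [E_fun] separates the powers of |h|, collected in
    [calQ] and [Y_const], from those of |k|. *)
Lemma scrK_le_expansion k : mu * rho <= znorm R k ->
  scrK p n rho k <=
    8 * \sum_(j < m.+1)
      (calQ n rho gamma Q j ((znorm R k)^-1 *: rvec R k) / znorm R k `^ gamma j)
    + 8 * (V_const mu m S * Y_const n d rho m gamma / znorm R k `^ gamma m.+1).
Proof.
move=> kr; have rk : rho < znorm R k.
  by rewrite (lt_le_trans _ kr)// ltr_pMl.
have K0 : 0 < znorm R k by exact: lt_trans rk.
have k0 : k != 0.
  by apply: contraTneq K0 => ->; rewrite /znorm (eqP (_ :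
    rvec R 0 == 0)) ?rvec_eq0// /norm2 (eqP (_ : dot 0 0 == 0)) ?dot_eq0// sqrtr0 ltxx.
(* As |k| > rho, the point [k] already lies outside the ball. *)
have E : punctured_ball rho k = zball0.
  apply/seteqP; split => h [h0 hr]; split => //; first by case: h0.
  by split => //; apply: contraTneq hr => ->; rewrite -leNgt ltW.
apply: (le_trans (scrK_le_E p n rho0 k0)); rewrite E -mulrDr ler_pM2l//.
have fb := finite_zball0.
rewrite (fsumr_finite _ fb) /calQ /Y_const -/zball0 (fsumr_finite _ fb).
under [in leRHS]eq_bigr do rewrite (fsumr_finite _ fb) mulr_suml.
rewrite exchange_big/= mulr_sumr mulr_suml -big_split/= big_seq [leRHS]big_seq.
apply: ler_sum => h; rewrite in_fset_set ?inE => [[h0 hr]|//].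
have X0 : 0 < znorm R h by exact: znorm_gt0.
have [_ _ _ hE] := hQS.
have rh0 : rvec R h != 0 by rewrite rvec_eq0.
have rk0 : rvec R k != 0 by rewrite rvec_eq0.
have [_ hc] := cos_angle rh0 rk0.
set c := cos _ in hc *; set xi := znorm R h / znorm R k.
have xi0 : 0 <= xi by rewrite divr_ge0// ltW.
have ximu : xi <= 1 / mu.
  rewrite ler_pdivrMr// mulrAC ler_pdivlMr// mul1r (le_trans _ kr)// mulrC ler_pM2l//
    ltW//.
have xi1 : xi < 1 by rewrite ltr_pdivrMr// mul1r (lt_trans hr).
have Ed : Edom (c, xi).
  by split => //= -[_ xE]; move: xi1; rewrite xE ltxx.
have powE j : 1 / znorm R h `^ (2 * n) * xi `^ gamma j =
    1 / znorm R h `^ (2 * n - gamma j) / znorm R k `^ gamma j.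
  rewrite powRB ?(gt_eqF X0) ?implybT// /xi powRM ?invr_ge0 ?(ltW X0) ?(ltW K0)//.
  rewrite -[(znorm R k)^-1]powR_inv1 ?(ltW K0)// -powRrM mulN1r powRN.
  by rewrite !mul1r invfM invrK mulrA.
rewrite (hE m c xi Ed) mulrDr mulr_sumr lerD//.
  apply: ler_sum => j _; rewrite angleZ ?invr_gt0// -/c.
  rewrite mulrCA powE mul1r !mulrA le_eqVlt; apply/orP; left; apply/eqP; ring.
rewrite mulrCA powE -[leRHS]mulrA ler_wpM2r//.
  by rewrite mul1r mulr_ge0// invr_ge0 powR_ge0.
by apply: V_const_ge; rewrite ?xi0.
Qed.

Lemma expansion_le_frakK k : mu * rho <= znorm R k ->
  8 * \sum_(j < m.+1)
      (calQ n rho gamma Q j ((znorm R k)^-1 *: rvec R k) / znorm R k `^ gamma j)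
    + 8 * (V_const mu m S * Y_const n d rho m gamma / znorm R k `^ gamma m.+1)
  <= frakK n d rho mu m gamma Q S.
Proof.
move=> kr; have mr0 : 0 < mu * rho by rewrite mulr_gt0.
have K0 : 0 < znorm R k by exact: lt_le_trans kr.
have [q hq] := coef_poly.
set VY := V_const mu m S * Y_const n d rho m gamma.
rewrite -mulrDr /frakK ler_pM2l// -/VY.
(* A continuous extension of the maximized function to the whole space, through |eps| and
   polynomials; the two agree for u on the sphere and eps >= 0. *)
pose f (x : 'rV[R]_d * R) : R :=
  \sum_(j < m.+1) `|x.2| `^ gamma j * (\sum_(h <- fset_set zball0)
    (q j).[dot (rvec R h) x.1 / znorm R h] / znorm R h `^ (2 * n - gamma j))
  + VY * `|x.2| `^ gamma m.+1.
have cf : continuous f.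
  move=> x; apply: cvgD.
    apply: continuous_bigsum => j; apply: cvgM.
      apply: (@cvg_comp _ _ _ (fun x : 'rV[R]_d * R => x.2) (fun w =>
        `|w| `^ gamma j) _ (nbhs x.2)).
        exact: cvg_snd.
      exact/continuous_normr_powR/exponent_ge0.
    apply: continuous_bigsum => h; apply: cvgM; last exact: cvg_cst.
    apply: (@cvg_comp _ _ _ (fun x : 'rV[R]_d * R => dot (rvec R h) x.1 / znorm R h)
      (horner (q j)) _ (nbhs (dot (rvec R h) x.1 / znorm R h)));
        last exact: continuous_horner.
    apply: cvgM; last exact: cvg_cst.
    apply: (@cvg_comp _ _ _ (fun x : 'rV[R]_d * R => x.1) (fun u =>
      dot (rvec R h) u) _ (nbhs x.1)).
      exact: cvg_fst.
    exact: continuous_dot.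
  apply: cvgM; first exact: cvg_cst.
  apply: (@cvg_comp _ _ _ (fun x : 'rV[R]_d * R => x.2) (fun w =>
    `|w| `^ gamma m.+1) _ (nbhs x.2)).
    exact: cvg_snd.
  exact/continuous_normr_powR/exponent_ge0.
have fE u eps : sphere u -> 0 <= eps -> f (u, eps) =
    \sum_(j < m.+1) eps `^ gamma j * calQ n rho gamma Q j u + VY * eps `^ gamma m.+1.
  move=> su e0; rewrite /f/= ger0_norm//; congr (_ + _); apply: eq_bigr => j _.
  by rewrite (calQ_sphereE j hq su).
apply: (@le_maximum_compact R _ (@sphere R d `*` `[0, 1 / (mu * rho)]%classic) f).
- by apply: compact_setX; [exact: compact_sphere|exact: segment_compact].
- exact: continuous_subspaceT.
- apply/seteqP; split => [_ [u su [e e1 <-]]|_ [[u e] [/= su e1] <-]].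
    exists (u, e) => //; rewrite fE//.
    by move: e1; rewrite /= in_itv/= => /andP[].
  exists u => //; exists e => //; rewrite fE//.
  by move: e1; rewrite /= in_itv/= => /andP[].
(* The bound at [k] is the value at u = k / |k| and eps = 1 / |k|. *)
exists ((znorm R k)^-1 *: rvec R k).
  by rewrite /sphere/= norm2Z gtr0_norm ?invr_gt0// mulVf// gt_eqF.
exists ((znorm R k)^-1).
  by rewrite /= in_itv/= invr_ge0 ltW//= mul1r lef_pV2 ?posrE.
have ipow (a : R) : (znorm R k)^-1 `^ a = (znorm R k `^ a)^-1.
  by rewrite -powR_inv1 ?(ltW K0)// -powRrM mulN1r powRN.
rewrite ipow; congr (_ + _).
by apply: eq_bigr => j _; rewrite ipow mulrC.
Qed.

End Expansion.

Theorem proposition6p1 (R : realType) (d : nat) (p n rho mu : R) (m : nat)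
    (gamma : nat -> R) (Q : nat -> R -> R) (S : nat -> R * R -> R)
    (hd : (2 <= d)%N) (hn : d%:R / 2 < n) (hpn : n <= p)
    (hrho : 2 * Num.sqrt d%:R < rho) (hmu : 1 < mu)
    (hgamma : is_exponent_enum p n gamma)
    (hQS : is_expansion p n gamma Q S) :
  (* calK takes values in (0, +oo) *)
  (forall k : 'rV[int]_d, Z0 k -> (0 < calK p n k < +oo)%E) /\
  (* (i) *)
  (forall k : 'rV[int]_d, Z0 k ->
    [/\ ((scrK p n rho k)%:E < calK p n k)%E,
        (calK p n k <= (scrK p n rho k + deltaK p n d rho)%:E)%E,
        scrK p n rho k =
          4 * znorm R k `^ (2 * p) *
          \sum_(h \in [set h | Z0k k h /\ znorm R h < rho])
            ((Pnorm R h (k - h) ^+ 2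
              + heaviside (znorm R (k - h) - rho) * Pnorm R (k - h) h ^+ 2)
             / weight p n k h) &
        2 * rho <= znorm R k ->
        scrK p n rho k =
          4 * znorm R k `^ (2 * p) *
          \sum_(h \in [set h | Z0 h /\ znorm R h < rho])
            ((Pnorm R h (k - h) ^+ 2 + 1 * Pnorm R (k - h) h ^+ 2)
             / weight p n k h)]) /\
  (* (ii) *)
  (forall (r : 'I_d) (s : 'S_d) (k : 'rV[int]_d), Z0 k ->
    scrK p n rho (reflect_coord r k) = scrK p n rho k /\
    scrK p n rho (permute_coord s k) = scrK p n rho k) /\
  (* (iii) *)
  [/\ forall k : 'rV[int]_d, Z0 k ->
        scrK p n rho k <=
          8 * \sum_(h \in [set h | Z0k k h /\ znorm R h < rho])
            (1 / znorm R h `^ (2 * n)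
             * E_fun p n (cos (angle (rvec R h) (rvec R k)))
                         (znorm R h / znorm R k)),
      forall k : 'rV[int]_d, mu * rho <= znorm R k ->
        let bound :=
          8 * \sum_(j < m.+1)
            (calQ n rho gamma Q j ((znorm R k)^-1 *: rvec R k)
             / znorm R k `^ gamma j)
          + 8 * (V_const mu m S * Y_const n d rho m gamma
                 / znorm R k `^ gamma m.+1) in
        scrK p n rho k <= bound /\ bound <= frakK n d rho mu m gamma Q S &
      forall j : nat, exists q : mpoly.mpoly d R,
        forall u : 'rV[R]_d, sphere u ->
          calQ n rho gamma Q j u = mpoly.meval (fun i => u 0 i) q] /\
  (* (iv) *)
  (ereal_sup [set calK p n k | k in @Z0 d] <=
    (Num.max (maximum [set scrK p n rho k |
                       k in [set k : 'rV[int]_d | Z0 k /\ znorm R k < mu * rho]])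
             (frakK n d rho mu m gamma Q S)
     + deltaK p n d rho)%:E)%E.
Proof.
have n0 : 0 < n by apply: le_lt_trans hn; rewrite divr_ge0.
have rho0 : 0 < rho by apply: le_lt_trans hrho; rewrite mulr_ge0 ?sqrtr_ge0.
have lo (k : 'rV[int]_d) : Z0 k -> ((scrK p n rho k)%:E < calK p n k)%E.
  move=> k0; have kp : 0 < 4 * znorm R k `^ (2 * p).
    by rewrite mulr_gt0// powR_gt0// znorm_gt0.
  rewrite (calK_split p n rho k) lteDl// mule_gt0 ?lte_fin//.
  have [h fh hgt] := far_kterm_gt0 hd hn hpn hrho k0.
  apply: (@lt_le_trans _ _ (kterm p n k h)%:E); first by rewrite lte_fin.
  apply: esum_ge; exists [set h]; first by split => // x ->.
  by rewrite fsbig_set1.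
have up (k : 'rV[int]_d) : Z0 k ->
    (calK p n k <= (scrK p n rho k + deltaK p n d rho)%:E)%E.
  move=> k0; rewrite (calK_split p n rho k) EFinD leeD2l//.
  exact: far_esum_le.
have scr0 (k : 'rV[int]_d) : 0 <= scrK p n rho k.
  rewrite scrKE mulr_ge0 ?mulr_ge0 ?powR_ge0//; apply: fsumr_ge0 => h _.
  exact: kterm_ge0.
have frak (k : 'rV[int]_d) : mu * rho <= znorm R k ->
    scrK p n rho k <= frakK n d rho mu m gamma Q S.
  move=> kr; apply: (le_trans (scrK_le_expansion m rho0 hmu hQS kr)).
  exact: (expansion_le_frakK m hpn rho0 hmu hgamma hQS).
split.
  move=> k k0; apply/andP; split.
    by apply: le_lt_trans (lo k k0); rewrite lee_fin.
  by apply: le_lt_trans (up k k0) _; rewrite ltry.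
split.
  move=> k k0; split; [exact: lo|exact: up|exact: scrK_heaviside|].
  exact: scrK_large.
split.
  by move=> r s k _; rewrite scrK_reflect scrK_permute.
split.
  split.
  - by move=> k k0; exact: scrK_le_E.
  - move=> k kr; split; first exact: (scrK_le_expansion m rho0 hmu hQS kr).
    exact: (expansion_le_frakK m hpn rho0 hmu hgamma hQS).
  - by move=> j; exact: (calQ_mpoly d rho hQS j).
apply: ge_ereal_sup => _ [k k0 <-]; apply: (le_trans (up k k0)).
rewrite lee_fin lerD2r le_max.
have [kr|kr] := ltP (znorm R k) (mu * rho); last by rewrite frak ?orbT.
apply/orP; left.
set D := [set k : 'rV[int]_d | Z0 k /\ znorm R k < mu * rho].
have fD : finite_set D by apply: sub_finite_set (finite_ball d (mu * rho)) => h [].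
have fA : finite_set (scrK p n rho @` D) by exact: finite_image.
have kA : (scrK p n rho @` D) (scrK p n rho k) by exists k.
(* Finitely many values form a compact set, on which the identity attains its maximum. *)
apply: (@le_maximum_compact R R (scrK p n rho @` D) id) => //.
- exact: finite_compact.
- by apply: continuous_subspaceT => x; exact: cvg_id.
- by rewrite image_id.
Qed.
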